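(* There is an algorithm which, given a finite simple graph $G$ with vertex integrity $\iota(G)\le k$ and a First-Order (FO) sentence $\phi$ in prenex form having at most $q$ quantifiers, decides whether $G\models\phi$ in time $(2^{O(k^2)}\cdot q)^q+\mathrm{poly}(|G|)$.
   Context: The vertex integrity $\iota(G)$ of a graph $G$ is the minimum, over all sets $S\subseteq V(G)$, of $|S|+|S'|$, where $S'$ is the vertex set of a largest connected component of $G\setminus S$. FO formulas over graphs are built from atoms $x\sim y$ (adjacency), $x=y$, using $\lor$, $\neg$ and existential quantification $\exists x$ over vertices (with $\land,\forall$ as derived operations); a sentence has no free variables, and prenex form means all quantifiers appear at the beginning of the formula. $G\models\phi$ means that $G$ satisfies $\phi$ under the standard semantics.
   Formalization: The formal time bound is (2^{O(k^2)}·q)^q·|φ| + poly(|G|): a factor |φ|, the length of φ, is added, since the quantifier-free part can be arbitrarily long for fixed q and must be read, so the bound without it fails already for q = 1 on one vertex. *)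

(* Defs.v *)
From mathcomp Require Import all_boot.
Set Implicit Arguments. Unset Strict Implicit. Unset Printing Implicit Defensive.

Record graph (n : nat) := Graph {
  adj : rel 'I_n;
  adj_sym : symmetric adj;
  adj_irr : irreflexive adj }.

Definition del_rel n (G : graph n) (S : {set 'I_n}) : rel 'I_n :=
  fun x y => [&& x \notin S, y \notin S & adj G x y].

Definition max_comp n (G : graph n) (S : {set 'I_n}) : nat :=
  \max_(x in ~: S) #|[set y | connect (del_rel G S) x y]|.

(* vertex integrity: min over S of |S| + |largest component of G \ S|.
   The default value n is attained by S = V, so it does not alter the min. *)
Definition vertex_integrity n (G : graph n) : nat :=
  \big[minn/n]_(S : {set 'I_n}) (#|S| + max_comp G S).

Inductive form : Type :=
| FAdj of nat & nat
| FEq  of nat & nat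
| FOr  of form & form
| FNot of form
| FEx  of nat & form.

Definition FAll (x : nat) (f : form) : form := FNot (FEx x (FNot f)).

Fixpoint free_in (v : nat) (f : form) : bool :=
  match f with
  | FAdj x y | FEq x y => (x == v) || (y == v)
  | FOr f g => free_in v f || free_in v g
  | FNot f => free_in v f
  | FEx x f => (x != v) && free_in v f
  end.

Definition sentence (f : form) : Prop := forall v, ~~ free_in v f.

Fixpoint qfree (f : form) : bool :=
  match f with
  | FAdj _ _ | FEq _ _ => true
  | FOr f g => qfree f && qfree g
  | FNot f => qfree f
  | FEx _ _ => false
  end.

Inductive prenex : form -> Prop :=
| prenex_qf f : qfree f -> prenex f
| prenex_ex x f : prenex f -> prenex (FEx x f)
| prenex_all x f : prenex f -> prenex (FAll x f).

(* number of quantifiers (each forall contributes one existential) *)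
Fixpoint nquant (f : form) : nat :=
  match f with
  | FAdj _ _ | FEq _ _ => 0
  | FOr f g => nquant f + nquant g
  | FNot f => nquant f
  | FEx _ f => (nquant f).+1
  end.

Definition upd n (env : nat -> option 'I_n) (x : nat) (v : 'I_n) :=
  fun y => if y == x then Some v else env y.

Fixpoint sat n (G : graph n) (env : nat -> option 'I_n) (f : form) : Prop :=
  match f with
  | FAdj x y => match env x, env y with
                | Some a, Some b => adj G a b
                | _, _ => False end
  | FEq x y => match env x, env y with
                | Some a, Some b => a = b
                | _, _ => False end
  | FOr f g => sat G env f \/ sat G env g
  | FNot f => ~ sat G env f
  | FEx x f => exists v : 'I_n, sat G (upd env x v) f
  end.

Definition models n (G : graph n) (f : form) : Prop := sat G (fun _ => None) f.

Inductive instr : Type :=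
| IConst of nat & nat
| IAdd of nat & nat & nat
| ISub of nat & nat & nat      (* r := a - b (truncated) *)
| ILoad of nat & nat
| IStore of nat & nat
| IJz of nat & nat
| IHalt.

Definition program := seq instr.

Record ram_state := RS { pc : nat; mem : nat -> nat }.

Definition wr (m : nat -> nat) (r v : nat) : nat -> nat :=
  fun i => if i == r then v else m i.

Definition step (i : instr) (s : ram_state) : ram_state :=
  let m := mem s in let p := pc s in
  match i with
  | IConst r c => RS p.+1 (wr m r c)
  | IAdd r a b => RS p.+1 (wr m r (m a + m b))
  | ISub r a b => RS p.+1 (wr m r (m a - m b))
  | ILoad r a => RS p.+1 (wr m r (m (m a)))
  | IStore a r => RS p.+1 (wr m (m a) (m r))
  | IJz r l => if m r == 0 then RS l m else RS p.+1 m
  | IHalt => s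
  end.

(* run for at most [fuel] steps; Some (M[0]) if the machine halts
   (Halt instruction or pc outside the program) within that many steps *)
Fixpoint exec (P : program) (fuel : nat) (s : ram_state) : option nat :=
  match fuel with
  | 0 => None
  | f.+1 => match nth IHalt P (pc s) with
            | IHalt => Some (mem s 0)
            | i => exec P f (step i s)
            end
  end.

Definition init (inp : seq nat) : ram_state :=
  RS 0 (fun i => if i is j.+1 then nth 0 inp j else size inp).

Fixpoint enc_form (f : form) : seq nat :=
  match f with
  | FAdj x y => [:: 0; x; y]
  | FEq x y => [:: 1; x; y]
  | FOr f g => 2 :: enc_form f ++ enc_form g
  | FNot f => 3 :: enc_form f
  | FEx x f => 4 :: x :: enc_form f
  end.

Definition enc_graph n (G : graph n) : seq nat :=
  n :: [seq nat_of_bool (adj G i j) | i <- enum 'I_n, j <- enum 'I_n].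

Definition enc_input n (G : graph n) (f : form) : seq nat :=
  enc_graph G ++ enc_form f.

(* Main.v *)
(* If |S| plus the largest component of G \ S is at most k, then every vertex of
   degree at least k lies in S.  Hence for the threshold set D of all vertices of
   degree at least k, the components of G \ D that meet S have at most k + k^3
   vertices in total, and the others have size at most k.  Call two components
   similar when their order isomorphism preserves adjacency inside the components
   and to D; there are 2^O(k^2) classes of small components.  Swapping two similar
   components is an automorphism of G, so if d vertices have been quantified so far,
   each in one of the first d components of its class, the next quantifier need
   only range over the first d+1 components of each class: an untouched one is among
   them.  This leaves (d+1) 2^O(k^2) candidates.  Correctness holds for every
   threshold, so k need not be known: the program tries all thresholds and keeps the
   one with fewest candidates at depth 0.

   The program is written in a loop language with bounded sums, compiled to the RAM;
   as every loop and sum ranges over 0..n-1, polynomial running time of the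
   preprocessing is a syntactic fact. *)
Require Import Defs.
From mathcomp Require Import all_boot.
From mathcomp Require Import zify.
Set Implicit Arguments. Unset Strict Implicit. Unset Printing Implicit Defensive.

(** * A loop language and its compilation to the RAM *)

(** A minimising set [S] is never computed: it occurs only in the analysis, while [D] is read off
    from the degrees and is contained in [S] once the threshold equals the vertex integrity. The
    price is that components of G \ D meeting [S] can be large; their vertices are counted one by
    one, without any use of similarity. Parts are compared along the numbering of their vertices
    instead of up to arbitrary isomorphism. This makes the test a fixed nest of loops and the
    exchange of two parts a canonical map, and 2^O(k^2) still bounds the number of types.

    The loop language can only express polynomial time, so it cannot run the search itself. The
    search is a stack machine over the encoded formula; its single transition [c_step] contains
    neither a loop nor a sum and so has constant cost. The only unbounded loop of the program
    iterates this transition, and the exponential term is the number of transitions times that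
    constant.

    At depth d the number of candidates is at most d+1 times the number at depth 0, which is why
    comparing thresholds by the latter is enough. *)

Inductive expr : Type :=
| EC of nat
| EV of nat
| EAdd of expr & expr
| ESub of expr & expr
| EA of nat & expr
| ESum of nat & expr.

Inductive cmd : Type :=
| CSet of nat & expr
| CSt of nat & expr & expr
| CSeq of cmd & cmd
| CIf of expr & cmd & cmd
| CFor of nat & cmd.

Record state := St { var : nat -> nat; arr : nat -> nat -> nat }.

Definition setv s x v := St (fun y => if eqn y x then v else var s y) (arr s).
Definition seta s a i v :=
  St (var s) (fun b j => if eqn b a then if j == i then v else arr s b j else arr s b j).

(* Variable 0 holds the bound of every sum and every loop. *)
Fixpoint eval (e : expr) (s : state) : nat :=
  match e with
  | EC c => c
  | EV x => var s x
  | EAdd a b => eval a s + eval b s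
  | ESub a b => eval a s - eval b s
  | EA a e => arr s a (eval e s)
  | ESum x e => \sum_(i < var s 0) eval e (setv s x i)
  end.

(** A loop leaves its counter equal to the bound, because the compiled loop does so. *)
Fixpoint run (c : cmd) (s : state) : state :=
  match c with
  | CSet x e => setv s x (eval e s)
  | CSt a i e => seta s a (eval i s) (eval e s)
  | CSeq c1 c2 => run c2 (run c1 s)
  | CIf e c1 c2 => if eval e s == 0 then run c2 s else run c1 s
  | CFor x c =>
      setv (iteri (var s 0) (fun i s' => run c (setv s' x i)) s) x (var s 0)
  end.

(** Register layout: 1 is the base of the arrays, 2 to 29 hold the variables, 30 to 81 the stack of
    intermediate values. Arrays start at address 82 or later. *)
Definition NV := 28.
Definition TD := 52.
Definition va x := x + 2.
Definition ta d := d + 30.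
Definition RMAX := 82.

(* Entry i of array a lives at address B + 32 i + a, with B in register 1. *)
Definition addr d a :=
  [:: IAdd (ta d) (ta d) (ta d); IAdd (ta d) (ta d) (ta d);
      IAdd (ta d) (ta d) (ta d); IAdd (ta d) (ta d) (ta d);
      IAdd (ta d) (ta d) (ta d); IConst (ta d.+1) a;
      IAdd (ta d) (ta d) (ta d.+1); IAdd (ta d) (ta d) 1].

Fixpoint len_e (e : expr) : nat :=
  match e with
  | EC _ => 1
  | EV _ => 2
  | EAdd a b | ESub a b => len_e a + len_e b + 1
  | EA _ e => len_e e + 9
  | ESum _ e => len_e e + 13
  end.

(** Jumps are absolute, hence the code address [p]; [d] is the stack height, and the value is left
    in [ta d]. Lacking a move and an unconditional jump, the code copies by adding to a zeroed
    register and jumps by testing one. A sum keeps the old value of its variable in [ta d.+1] and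
    restores it at the end. *)
Fixpoint comp_e (p d : nat) (e : expr) : seq instr :=
  match e with
  | EC c => [:: IConst (ta d) c]
  | EV x => [:: IConst (ta d) 0; IAdd (ta d) (va x) (ta d)]
  | EAdd a b => comp_e p d a ++ comp_e (p + len_e a) d.+1 b ++
                [:: IAdd (ta d) (ta d) (ta d.+1)]
  | ESub a b => comp_e p d a ++ comp_e (p + len_e a) d.+1 b ++
                [:: ISub (ta d) (ta d) (ta d.+1)]
  | EA a e => comp_e p d e ++ addr d a ++ [:: ILoad (ta d) (ta d)]
  | ESum x e =>
      [:: IConst (ta d) 0; IConst (ta d.+1) 0; IAdd (ta d.+1) (va x) (ta d.+1);
          IConst (va x) 0;
          ISub (ta d.+2) (va 0) (va x); IJz (ta d.+2) (p + len_e e + 11)] ++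
      comp_e (p + 6) d.+2 e ++
      [:: IAdd (ta d) (ta d) (ta d.+2); IConst (ta d.+2) 1;
          IAdd (va x) (va x) (ta d.+2); IConst (ta d.+2) 0; IJz (ta d.+2) (p + 4);
          IConst (ta d.+2) 0; IAdd (va x) (ta d.+1) (ta d.+2)]
  end.

Fixpoint len_c (c : cmd) : nat :=
  match c with
  | CSet _ e => len_e e + 2
  | CSt _ i e => len_e i + 8 + len_e e + 1
  | CSeq c1 c2 => len_c c1 + len_c c2
  | CIf e c1 c2 => len_e e + 1 + len_c c1 + 2 + len_c c2
  | CFor _ c => len_c c + 7
  end.

Fixpoint comp_c (p : nat) (c : cmd) : seq instr :=
  match c with
  | CSet x e => comp_e p 0 e ++ [:: IConst (ta 1) 0; IAdd (va x) (ta 0) (ta 1)]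
  | CSt a i e => comp_e p 0 i ++ addr 0 a ++ comp_e (p + len_e i + 8) 1 e ++
                 [:: IStore (ta 0) (ta 1)]
  | CSeq c1 c2 => comp_c p c1 ++ comp_c (p + len_c c1) c2
  | CIf e c1 c2 =>
      comp_e p 0 e ++ [:: IJz (ta 0) (p + len_e e + 1 + len_c c1 + 2)] ++
      comp_c (p + len_e e + 1) c1 ++
      [:: IConst (ta 0) 0; IJz (ta 0) (p + len_e e + 1 + len_c c1 + 2 + len_c c2)] ++
      comp_c (p + len_e e + 1 + len_c c1 + 2) c2
  | CFor x c =>
      [:: IConst (va x) 0; ISub (ta 0) (va 0) (va x); IJz (ta 0) (p + len_c c + 7)] ++
      comp_c (p + 3) c ++
      [:: IConst (ta 0) 1; IAdd (va x) (va x) (ta 0); IConst (ta 0) 0; IJz (ta 0) (p + 1)]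
  end.

Lemma size_comp_e p d e : size (comp_e p d e) = len_e e.
Proof.
elim: e p d => //=.
- by move=> a IHa b IHb p d; rewrite !size_cat IHa IHb /= addnA.
- by move=> a IHa b IHb p d; rewrite !size_cat IHa IHb /= addnA.
- by move=> a e IH p d; rewrite !size_cat IH.
- by move=> x e IH p d; rewrite size_cat IH /=; lia.
Qed.

Lemma size_comp_c p c : size (comp_c p c) = len_c c.
Proof.
elim: c p => /=.
- by move=> x e p; rewrite size_cat size_comp_e.
- by move=> a i e p; rewrite !size_cat !size_comp_e /= !size_cat size_comp_e /=; lia.
- by move=> c1 IH1 c2 IH2 p; rewrite size_cat IH1 IH2.
- by move=> e c1 IH1 c2 IH2 p; rewrite !(size_cat, IH1, IH2, size_comp_e) /= !(size_cat, IH1, IH2) /= IH2; lia.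
- by move=> x c IH p; rewrite size_cat IH /=; lia.
Qed.

(** The index is only an upper bound on the number of steps, so estimates can be relaxed at any
    point. *)
Inductive reach (P : program) : nat -> ram_state -> ram_state -> Prop :=
| reach0 b s : reach P b s s
| reachS b s s' : nth IHalt P (pc s) <> IHalt ->
    reach P b (step (nth IHalt P (pc s)) s) s' -> reach P b.+1 s s'.

Lemma reach_le P b b' s s' : b <= b' -> reach P b s s' -> reach P b' s s'.
Proof.
move=> le H; elim: H b' le => [{}b {}s|{}b {}s {}s' nH _ IH] [|b'] // le;
  try exact: reach0.
by apply: reachS => //; apply: IH.
Qed.

Lemma reach_trans P b1 b2 s1 s2 s3 :
  reach P b1 s1 s2 -> reach P b2 s2 s3 -> reach P (b1 + b2) s1 s3.
Proof.
elim=> [b s|b s s' nH _ IH] H; first by apply: reach_le H; lia.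
by apply: reachS => //; apply: IH.
Qed.

Lemma exec_reach P b f s s' v :
  reach P b s s' -> exec P f s' = Some v -> exec P (b + f) s = Some v.
Proof.
have mono : forall f g s, exec P f s = Some v -> exec P (g + f) s = Some v.
  elim=> [|f0 IH] g s0 //=; rewrite addnS /=.
  by case: (nth IHalt P (pc s0)) => // *; apply: IH.
elim=> [b0 s0|b0 s0 s1 nH _ IH] H; first exact: mono.
move/IH: H => H /=.
by case: (nth IHalt P (pc s0)) nH H.
Qed.

Definition code_at (P : program) p (c : seq instr) :=
  forall i, i < size c -> nth IHalt P (p + i) = nth IHalt c i.

Lemma code_at_cat P p c1 c2 :
  code_at P p (c1 ++ c2) -> code_at P p c1 /\ code_at P (p + size c1) c2.
Proof.
move=> H; split=> i Hi.
  by rewrite H ?size_cat ?nth_cat ?Hi //; lia.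
rewrite -addnA H ?size_cat ?nth_cat; last by lia.
by rewrite ltnNge leq_addr /= addKn.
Qed.

Lemma code_at_cons P p i c :
  code_at P p (i :: c) -> nth IHalt P p = i /\ code_at P p.+1 c.
Proof.
move=> H; split; first by have := H 0 isT; rewrite addn0.
by move=> j Hj; rewrite addSnnS H.
Qed.

Lemma reach_step P p m b s' i :
  nth IHalt P p = i -> i <> IHalt -> reach P b (step i (RS p m)) s' ->
  reach P b.+1 (RS p m) s'.
Proof. by move=> H nH R; apply: reachS; rewrite /= H. Qed.

(** The simulation relation. Register 0 and the stack slots are left free; [RMAX <= m 1] keeps array
    cells away from the registers. *)
Definition rep (s : state) (m : nat -> nat) :=
  [/\ RMAX <= m 1, forall x, x < NV -> m (va x) = var s x
    & forall a i, a < 32 -> m (m 1 + 32 * i + a) = arr s a i].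

Lemma rep_ta s m d v : d < TD -> rep s m -> rep s (wr m (ta d) v).
Proof.
move=> Hd [H1 H2 H3]; rewrite /rep /wr /va /ta /RMAX /NV /TD in H1 H2 Hd *.
split.
- by case: eqP; lia.
- by move=> x Hx; case: eqP => [|_]; [lia|apply: H2].
- move=> a i Ha; have -> : (1 == d + 30) = false by apply/eqP; lia.
  by case: eqP => [|_]; [lia|apply: H3].
Qed.

Lemma rep_va s m x v : x < NV -> rep s m -> rep (setv s x v) (wr m (va x) v).
Proof.
move=> Hd [H1 H2 H3]; rewrite /rep /wr /va /RMAX /NV in H1 H2 Hd *.
split.
- by case: eqP; lia.
- move=> y Hy /=; case: eqnP => [->|ne]; first by rewrite eqxx.
  by case: eqP => [|_]; [lia|apply: H2].
- move=> a i Ha; have -> : (1 == x + 2) = false by apply/eqP; lia.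
  by case: eqP => [|_]; [lia|apply: H3].
Qed.

Lemma rep_arr s m a i v :
  a < 32 -> rep s m -> rep (seta s a i v) (wr m (m 1 + 32 * i + a) v).
Proof.
move=> Ha [H1 H2 H3]; rewrite /rep /wr /va /RMAX /NV in H1 H2 *.
split.
- by case: eqP; lia.
- by move=> y Hy /=; case: eqP => [|_]; [lia|apply: H2].
- move=> b j Hb; have -> : (1 == m 1 + 32 * i + a) = false by apply/eqP; lia.
  move=> /=; case: eqnP => [->|ne]; last by case: eqP => [|_]; [lia|apply: H3].
  case: (j =P i) => [->|ne']; first by rewrite eqxx.
  by case: eqP => [|_]; [lia|apply: H3].
Qed.

(** Evaluating an expression at height [d] is invisible below [d], so a left operand survives the
    computation of the right one. *)
Definition post s d (m m' : nat -> nat) :=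
  [/\ rep s m', m' 1 = m 1 & forall j, j < d -> m' (ta j) = m (ta j)].

Lemma post_trans s s' d d' m m' m'' :
  d <= d' -> post s d m m' -> post s' d' m' m'' -> post s' d m m''.
Proof.
move=> Hd [_ E1 K1] [R2 E2 K2]; split=> //; first by rewrite E2.
by move=> j Hj; rewrite K2 ?K1 //; lia.
Qed.

Lemma post_ta s d d' m m' v :
  d <= d' -> d' < TD -> post s d m m' -> post s d m (wr m' (ta d') v).
Proof.
move=> Hd Ht [R E K]; split; first exact: rep_ta.
- by rewrite /wr /ta; case: eqP => //; lia.
- by move=> j Hj; rewrite /wr /ta; case: eqP => [|_]; [lia|apply: K].
Qed.

Lemma post_va s d x m m' v :
  x < NV -> post s d m m' -> post (setv s x v) d m (wr m' (va x) v).
Proof.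
move=> Hx [R E K]; split; first exact: rep_va.
- by rewrite /wr /va; case: eqP => //; lia.
- move=> j Hj; rewrite /wr /ta /va; rewrite /NV in Hx.
  by case: eqP => [|_]; [lia|apply: K].
Qed.

Lemma wrE m r v : wr m r v r = v.
Proof. by rewrite /wr eqxx. Qed.

Lemma wr_ta m d d' v : d != d' -> wr m (ta d) v (ta d') = m (ta d').
Proof. by rewrite /wr /ta eqn_add2r eq_sym => /negbTE ->. Qed.

Lemma wr_va_ta m x d v : x < NV -> wr m (va x) v (ta d) = m (ta d).
Proof. by rewrite /wr /ta /va /NV => Hx; case: eqP => // ?; lia. Qed.

Lemma wr_ta_va m x d v : x < NV -> wr m (ta d) v (va x) = m (va x).
Proof. by rewrite /wr /ta /va /NV => Hx; case: eqP => // ?; lia. Qed.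

Lemma wr_ta1 m d v : wr m (ta d) v 1 = m 1.
Proof. by rewrite /wr /ta addnC. Qed.

(** * Correctness and cost of the compiled code *)

Fixpoint wf_e (d : nat) (e : expr) : bool :=
  match e with
  | EC _ => d < TD
  | EV x => (d < TD) && (x < NV)
  | EAdd a b | ESub a b => [&& d.+1 < TD, wf_e d a & wf_e d.+1 b]
  | EA a e => [&& d.+1 < TD, a < 32 & wf_e d e]
  | ESum x e => [&& d.+2 < TD, 0 < x, x < NV & wf_e d.+2 e]
  end.

Fixpoint bnd_e (e : expr) (N : nat) : nat :=
  match e with
  | EC _ => 1
  | EV _ => 2
  | EAdd a b | ESub a b => bnd_e a N + bnd_e b N + 1
  | EA _ e => bnd_e e N + 9
  | ESum _ e => N * (bnd_e e N + 7) + 8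
  end.

Lemma addr_ok P p d a s m i :
  code_at P p (addr d a) -> d.+1 < TD -> rep s m -> m (ta d) = i ->
  exists m', [/\ reach P 8 (RS p m) (RS (p + 8) m'), post s d m m' & m' (ta d) = m 1 + 32 * i + a].
Proof.
move=> C Hd R Ei.
have ne : d.+1 != d by lia.
have ne' : d != d.+1 by lia.
do 8 (case/code_at_cons: C => ? C).
eexists; split.
- do 8 (apply: reach_step; [by eassumption|by []|]; rewrite /=).
  have -> : p.+1.+1.+1.+1.+1.+1.+1.+1 = p + 8 by lia.
  exact: reach0.
- by repeat (apply: post_ta; [lia|lia|]).
- rewrite !(wrE, wr_ta1) !(wr_ta _ _ ne, wr_ta _ _ ne') !wrE Ei; lia.
Qed.

(** States contain functions, and restoring the variable of a sum gives back the old state only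
    pointwise. *)
Lemma post_ext s s' d m m' :
  var s =1 var s' -> (forall a, arr s a =1 arr s' a) ->
  post s d m m' -> post s' d m m'.
Proof.
move=> Ev Ea [[R1 R2 R3] E K]; split=> //; split=> //.
- by move=> x Hx; rewrite R2 ?Ev.
- by move=> a i Ha; rewrite R3 ?Ea.
Qed.

Lemma post_rep s d m m' : post s d m m' -> rep s m'.
Proof. by case. Qed.

Lemma setvE s x v : var (setv s x v) x = v.
Proof. by rewrite /=; have -> : eqn x x = true by exact: eqxx. Qed.

Lemma setvv s x u v : var (setv (setv s x u) x v) =1 var (setv s x v).
Proof. by move=> y /=; case: (eqn y x). Qed.

Lemma reach_jump P p m b s' r l :
  nth IHalt P p = IJz r l -> m r = 0 -> reach P b (RS l m) s' ->
  reach P b.+1 (RS p m) s'.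
Proof. by move=> H E R; apply: (reach_step H) => //=; rewrite E eqxx. Qed.

Lemma reach_skip P p m b s' r l :
  nth IHalt P p = IJz r l -> m r != 0 -> reach P b (RS p.+1 m) s' ->
  reach P b.+1 (RS p m) s'.
Proof. by move=> H E R; apply: (reach_step H) => //=; rewrite (negbTE E). Qed.

Ltac rstep := apply: reach_step; [by eassumption|by []|]; rewrite /=.

Lemma comp_e_ok P e p d s m :
  code_at P p (comp_e p d e) -> wf_e d e -> rep s m ->
  exists m', [/\ reach P (bnd_e e (var s 0)) (RS p m) (RS (p + len_e e) m'),
                post s d m m' & m' (ta d) = eval e s].
Proof.
elim: e p d s m => [c|x|a IHa b IHb|a IHa b IHb|a e IH|x e IH] p d s m /= C W R.
- case/code_at_cons: C => C1 _; exists (wr m (ta d) c); split.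
  + by rstep; rewrite addn1; apply: reach0.
  + by apply: post_ta.
  + exact: wrE.
- case/andP: W => Wd Wx.
  case/code_at_cons: C => C1 /code_at_cons [C2 _].
  eexists; split.
  + by rstep; rstep; rewrite -addn2; apply: reach0.
  + by do 2 apply: post_ta => //.
  + by rewrite !wrE wr_ta_va //; case: R => _ -> //; rewrite addn0.
- case/and3P: W => Wd Wa Wb.
  case/code_at_cat: C => Ca /code_at_cat [Cb C].
  case: (IHa _ _ _ _ Ca Wa R) => m1 [R1 P1 E1].
  rewrite !size_comp_e in Cb C.
  case: (IHb _ _ _ _ Cb Wb (post_rep P1)) => m2 [R2 P2 E2].
  case/code_at_cons: C => C _.
  eexists; split.
  + apply: reach_trans (reach_trans R1 R2) _; rstep.
    by rewrite !addnA addn1; apply: reach0.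
  + by apply: post_ta; [lia|lia|apply: (post_trans _ P1 P2)].
  + by rewrite wrE E2; case: P2 => _ _ ->; rewrite ?E1.
- case/and3P: W => Wd Wa Wb.
  case/code_at_cat: C => Ca /code_at_cat [Cb C].
  case: (IHa _ _ _ _ Ca Wa R) => m1 [R1 P1 E1].
  rewrite !size_comp_e in Cb C.
  case: (IHb _ _ _ _ Cb Wb (post_rep P1)) => m2 [R2 P2 E2].
  case/code_at_cons: C => C _.
  eexists; split.
  + apply: reach_trans (reach_trans R1 R2) _; rstep.
    by rewrite !addnA addn1; apply: reach0.
  + by apply: post_ta; [lia|lia|apply: (post_trans _ P1 P2)].
  + by rewrite wrE E2; case: P2 => _ _ ->; rewrite ?E1.
- case/and3P: W => Wd Wa We.
  case/(@code_at_cat _ _ (comp_e p d e)): C => Ce.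
  case/(@code_at_cat _ _ (addr d a) [:: _]) => Ca /code_at_cons [C _].
  rewrite size_comp_e in Ca C.
  case: (IH _ _ _ _ Ce We R) => m1 [R1 P1 E1].
  case: (addr_ok Ca Wd (post_rep P1) E1) => m2 [R2 P2 E2].
  eexists; split.
  + have -> : bnd_e e (var s 0) + 9 = bnd_e e (var s 0) + 8 + 1 by lia.
    apply: reach_trans (reach_trans R1 R2) _; rstep.
    have -> : (p + len_e e + 8).+1 = p + (len_e e + 9) by lia. exact: reach0.
  + by apply: post_ta; [lia|lia|apply: (post_trans _ P1 P2)].
  + rewrite wrE E2; case: P2 => [[_ _ A] Em _].
    by rewrite -Em A.
- case/and4P: W => Wd x0 Wx We.
  do 6 (case/code_at_cons: C => ? C).
  case/code_at_cat: C; rewrite size_comp_e => Ce C.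
  have E6 : p.+1.+1.+1.+1.+1.+1 = p + 6 by lia.
  rewrite {}E6 in Ce C.
  do 7 (case/code_at_cons: C => ? C).
  set N := var s 0; set be := bnd_e e N.
  have neq1 : d != d.+1 by lia.
  have neq2 : d != d.+2 by lia.
  have neq3 : d.+1 != d.+2 by lia.
  have neq1' : d.+1 != d by lia.
  have neq2' : d.+2 != d by lia.
  have neq3' : d.+2 != d.+1 by lia.
  have V0 i : var (setv s x i) 0 = N by case: (x) x0.
  (* Induction on the number [j] of rounds left, with [i] rounds done; the represented state differs
     from [s] only at [x]. *)
  have loop : forall j i m1, i + j = N -> post (setv s x i) d m m1 ->
     m1 (ta d) = \sum_(l < i) eval e (setv s x l) -> m1 (ta d.+1) = var s x ->
     exists m', [/\ reach P (j * (be + 7) + 4) (RS (p + 4) m1) (RS (p + (len_e e + 13)) m'),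
                post s d m m' & m' (ta d) = \sum_(l < N) eval e (setv s x l)].
    elim=> [|j IHj] i m1 Hij P1 Ea Es.
      have {}Hij : i = N by lia.
      case: (P1) => [[_ R1 _] _ _].
      eexists; split.
      - rewrite mul0n add0n; have -> : p + 4 = p.+4 by lia.
        rstep; apply: (reach_jump (r := ta d.+2)); first by eassumption.
          by rewrite wrE !R1 // V0 setvE Hij subnn.
        have -> : p + len_e e + 11 = (p + 6 + len_e e).+4.+1 by lia.
        rstep; rstep.
        have -> : (p + 6 + len_e e).+4.+3 = p + (len_e e + 13) by lia. exact: reach0.
      - rewrite wr_ta // wr_ta // Es wrE addn0.
        apply: (@post_ext (setv (setv s x i) x (var s x))) => //.
          by move=> y /=; case: eqnP => // ->.
        apply: post_va => //; apply: post_ta; [lia|lia|].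
        by apply: post_ta; [lia|lia|].
      - by rewrite wr_va_ta // !wr_ta // Ea Hij.
    case: (P1) => [[_ R1 _] _ _].
    have P2 : post (setv s x i) d m (wr m1 (ta d.+2) (m1 (va 0) - m1 (va x))).
      by apply: post_ta; [lia|lia|].
    case: (IH _ _ _ _ Ce We (post_rep P2)) => m2 [R2 P3 E3].
    rewrite V0 -/be in R2.
    set m3 := wr (wr (wr (wr m2 (ta d) (m2 (ta d) + m2 (ta d.+2))) (ta d.+2) 1) (va x)
                (i.+1)) (ta d.+2) 0.
    have Eta : m2 (ta d) = \sum_(l < i) eval e (setv s x l).
      by case: P3 => _ _ ->; rewrite ?wr_ta //; lia.
    have Exx : m2 (va x) = i.
      by case: P3 => [[_ -> //] _ _]; rewrite setvE.
    have E1 : m2 (ta d.+1) = var s x.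
      by case: P3 => _ _ ->; rewrite ?wr_ta //; lia.
    case: (IHj i.+1 m3) => [| | | |m' [R3 P4 E4]].
    + by lia.
    + rewrite /m3; apply: post_ta; [lia|lia|].
      apply: (@post_ext (setv (setv s x i) x i.+1)) => //; first exact: setvv.
      apply: post_va => //; apply: post_ta; [lia|lia|]; apply: post_ta; [lia|lia|].
      by apply: (post_trans _ P2 P3); lia.
    + rewrite /m3 wr_ta // wr_va_ta // wr_ta // wrE Eta E3.
      by rewrite big_ord_recr.
    + by rewrite /m3 wr_ta // wr_va_ta // wr_ta // wr_ta.
    exists m'; split=> //.
    have -> : j.+1 * (be + 7) + 4 = (be + (5 + (j * (be + 7) + 4))).+2 by lia.
    have -> : p + 4 = p.+4 by lia.
    rstep; apply: (reach_skip (r := ta d.+2)); first by eassumption.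
      by rewrite wrE !R1 // V0 setvE; lia.
    have -> : p.+4.+2 = p + 6 by lia.
    apply: reach_trans R2 _.
    do 4 rstep; apply: (reach_jump (r := ta d.+2)); first by eassumption.
      by rewrite wrE.
    suff -> : wr (wr (wr (wr m2 (ta d) (m2 (ta d) + m2 (ta d.+2))) (ta d.+2) 1) (va x)
      (wr (wr m2 (ta d) (m2 (ta d) + m2 (ta d.+2))) (ta d.+2) 1 (va x) +
       wr (wr m2 (ta d) (m2 (ta d) + m2 (ta d.+2))) (ta d.+2) 1 (ta d.+2))) (ta d.+2) 0 = m3 by [].
    by rewrite /m3 !wrE !wr_ta_va // Exx addn1.
  pose m0 := wr (wr (wr (wr m (ta d) 0) (ta d.+1) 0) (ta d.+1) (var s x)) (va x) 0.
  case: (loop N 0 m0) => [| | | |m' [R3 P4 E4]].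
  + by [].
  + by rewrite /m0; apply: post_va => //; do 3 (apply: post_ta; [lia|lia|]).
  + by rewrite /m0 wr_va_ta // 2?wr_ta // wrE big_ord0.
  + by rewrite /m0 wr_va_ta // wrE.
  exists m'; split=> //.
  have -> : N * (be + 7) + 8 = (N * (be + 7) + 4).+4 by lia.
  do 4 rstep.
  have -> : p.+4 = p + 4 by lia.
  suff -> : wr (wr (wr (wr m (ta d) 0) (ta d.+1) 0) (ta d.+1) (wr (wr m (ta d) 0) (ta d.+1) 0 (va x) + wr (wr m (ta d) 0) (ta d.+1) 0 (ta d.+1))) (va x) 0 = m0 by [].
  by rewrite /m0 wrE !wr_ta_va // addn0; case: R => _ ->.
Qed.

Fixpoint writes (c : cmd) (x : nat) : bool :=
  match c with
  | CSet y _ => eqn x y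
  | CSt _ _ _ => false
  | CSeq c1 c2 | CIf _ c1 c2 => writes c1 x || writes c2 x
  | CFor y c => eqn x y || writes c x
  end.

Fixpoint stores (c : cmd) (a : nat) : bool :=
  match c with
  | CSet _ _ => false
  | CSt b _ _ => eqn a b
  | CSeq c1 c2 | CIf _ c1 c2 => stores c1 a || stores c2 a
  | CFor _ c => stores c a
  end.

Lemma run_var c s x : ~~ writes c x -> var (run c s) x = var s x.
Proof.
elim: c s => [y e|a i e|c1 IH1 c2 IH2|e c1 IH1 c2 IH2|y c IH] s //=.
- by move/negbTE->.
- by rewrite negb_or => /andP [W1 W2]; rewrite IH2 ?IH1.
- by rewrite negb_or => /andP [W1 W2]; case: ifP => _; rewrite ?IH2 ?IH1.
- rewrite negb_or => /andP [W1 W2]; rewrite (negbTE W1).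
  by elim: (var s 0) => [|i IHi] //=; rewrite IH //= (negbTE W1).
Qed.

Lemma run_arr c s a : ~~ stores c a -> arr (run c s) a = arr s a.
Proof.
elim: c s => [y e|b i e|c1 IH1 c2 IH2|e c1 IH1 c2 IH2|y c IH] s //=.
- by move/negbTE->.
- by rewrite negb_or => /andP [W1 W2]; rewrite IH2 ?IH1.
- by rewrite negb_or => /andP [W1 W2]; case: ifP => _; rewrite ?IH2 ?IH1.
- by move=> W; elim: (var s 0) => [|i IHi] //=; rewrite IH.
Qed.

(** A loop body must not write its own counter: the semantics resets the counter each round, the
    compiled code increments it. *)
Fixpoint wf_c (c : cmd) : bool :=
  match c with
  | CSet x e => [&& 0 < x, x < NV & wf_e 0 e]
  | CSt a i e => [&& a < 32, wf_e 0 i & wf_e 1 e]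
  | CSeq c1 c2 => wf_c c1 && wf_c c2
  | CIf e c1 c2 => [&& wf_e 0 e, wf_c c1 & wf_c c2]
  | CFor x c => [&& 0 < x, x < NV, ~~ writes c x & wf_c c]
  end.

Lemma wf_writes0 c : wf_c c -> ~~ writes c 0.
Proof.
elim: c => [x e|a i e|c1 IH1 c2 IH2|e c1 IH1 c2 IH2|x c IH] //=.
- by case: x.
- by case/andP=> /IH1 H1 /IH2 H2; rewrite negb_or H1.
- by case/and3P=> _ /IH1 H1 /IH2 H2; rewrite negb_or H1.
- by case: x => // x /and4P [_ _ _ /IH].
Qed.

Fixpoint bnd_c (c : cmd) (N : nat) : nat :=
  match c with
  | CSet _ e => bnd_e e N + 2
  | CSt _ i e => bnd_e i N + bnd_e e N + 9
  | CSeq c1 c2 => bnd_c c1 N + bnd_c c2 N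
  | CIf e c1 c2 => bnd_e e N + bnd_c c1 N + bnd_c c2 N + 3
  | CFor _ c => N * (bnd_c c N + 6) + 3
  end.

Lemma comp_c_ok P c p s m :
  code_at P p (comp_c p c) -> wf_c c -> rep s m ->
  exists m', reach P (bnd_c c (var s 0)) (RS p m) (RS (p + len_c c) m') /\
             rep (run c s) m'.
Proof.
elim: c p s m => [x e|a i e|c1 IH1 c2 IH2|e c1 IH1 c2 IH2|x c IH] p s m /= C W R.
- case/and3P: W => x0 Wx We.
  case/code_at_cat: C => Ce; rewrite size_comp_e.
  case/code_at_cons=> C1 /code_at_cons [C2 _].
  case: (comp_e_ok Ce We R) => m1 [R1 P1 E1].
  eexists; split.
  + apply: reach_trans R1 _; rstep; rstep.
    have -> : (p + len_e e).+2 = p + (len_e e + 2) by lia.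
    exact: reach0.
  + rewrite wrE wr_ta // E1 addn0; apply: rep_va => //.
    by apply: rep_ta => //; apply: post_rep P1.
- case/and3P: W => Wa Wi We.
  case/(@code_at_cat _ _ (comp_e p 0 i)): C => Ci.
  case/(@code_at_cat _ _ (addr 0 a)) => Ca.
  rewrite !size_comp_e in Ca *.
  case/code_at_cat=> Ce; rewrite size_comp_e => /code_at_cons [C1 _].
  case: (comp_e_ok Ci Wi R) => m1 [R1 P1 E1].
  case: (addr_ok Ca isT (post_rep P1) E1) => m2 [R2 P2 E2].
  have We' : wf_e 1 e by [].
  case: (comp_e_ok Ce We' (post_rep P2)) => m3 [R3 P3 E3].
  eexists; split.
  + have -> : bnd_e i (var s 0) + bnd_e e (var s 0) + 9 =
      bnd_e i (var s 0) + 8 + bnd_e e (var s 0) + 1 by lia.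
    apply: reach_trans (reach_trans (reach_trans R1 R2) R3) _.
    rstep.
    have -> : (p + len_e i + 8 + len_e e).+1 = p + (len_e i + 8 + len_e e + 1) by lia.
    exact: reach0.
  + have Et : m3 (ta 0) = m3 1 + 32 * eval i s + a.
      by case: P3 => _ E K; rewrite K // E2 E; case: P2 => _ -> _.
    by rewrite Et E3; apply: rep_arr => //; apply: post_rep P3.
- case/andP: W => W1 W2; case/code_at_cat: C => C1; rewrite size_comp_c => C2.
  case: (IH1 _ _ _ C1 W1 R) => m1 [R1 P1].
  case: (IH2 _ _ _ C2 W2 P1) => m2 [R2 P2].
  exists m2; split=> //; rewrite addnA.
  by apply: reach_trans R1 _; rewrite -(run_var s (wf_writes0 W1)).
- case/and3P: W => We W1 W2.
  case/code_at_cat: C => Ce; rewrite size_comp_e.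
  case/code_at_cons=> C0 /code_at_cat [C1].
  rewrite !size_comp_c => /code_at_cons [C3] /code_at_cons [C4 C2].
  have E0 : (p + len_e e).+1 = p + len_e e + 1 by lia.
  have E3 : (p + len_e e + 1 + len_c c1).+2 = p + len_e e + 1 + len_c c1 + 2 by lia.
  rewrite E0 in C1 C3 C4 C2; rewrite E3 in C2.
  case: (comp_e_ok Ce We R) => m1 [R1 P1 E1].
  case: ifP => Ev.
  + case: (IH2 _ _ _ C2 W2 (post_rep P1)) => m2 [R2 P2].
    exists m2; split=> //.
    apply: (@reach_le _ (bnd_e e (var s 0) + (bnd_c c2 (var s 0)).+1)); first by lia.
    apply: reach_trans R1 _; apply: (reach_jump C0).
      by rewrite E1 (eqP Ev).
    by rewrite !addnA.
  + case: (IH1 _ _ _ C1 W1 (post_rep P1)) => m2 [R2 P2].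
    exists (wr m2 (ta 0) 0); split; last exact: rep_ta.
    apply: (@reach_le _ (bnd_e e (var s 0) + (bnd_c c1 (var s 0) + 2).+1)); first by lia.
    apply: reach_trans R1 _; apply: (reach_skip C0); first by rewrite E1 Ev.
    rewrite E0; apply: reach_trans R2 _; rstep.
    apply: (reach_jump C4); first by rewrite wrE.
    by rewrite !addnA; apply: reach0.
- case/and4P: W => x0 Wx Wn W.
  do 3 (case/code_at_cons: C => ? C).
  case/code_at_cat: C; rewrite size_comp_c.
  have E3 : p.+3 = p + 3 by lia.
  rewrite {}E3 => Cc C.
  do 4 (case/code_at_cons: C => ? C).
  set N := var s 0; set b := bnd_c c N.
  set F := fun i => iteri i (fun i s' => run c (setv s' x i)) s.
  have V0 i : var (setv (F i) x i) 0 = N.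
    case: (x) x0 Wx Wn @F => // y _ Wx Wn F /=.
    elim: i => [|i IHi] //; rewrite /F iteriS run_var //.
    exact: wf_writes0.
  have loop : forall j i m1, i + j = N -> rep (setv (F i) x i) m1 ->
     exists m', reach P (j * (b + 6) + 2) (RS (p + 1) m1) (RS (p + (len_c c + 7)) m') /\
       rep (setv (F N) x N) m'.
    elim=> [|j IHj] i m1 Hij P1; case: (P1) => [_ R1 _].
      have {}Hij : i = N by lia.
      exists (wr m1 (ta 0) (m1 (va 0) - m1 (va x))); split.
      - rewrite mul0n addn1; rstep.
        apply: reach_jump; first by eassumption.
          by rewrite wrE !R1 // V0 setvE Hij subnn.
        by rewrite addnA; apply: reach0.
      - by rewrite -{1}Hij -{1}Hij; apply: rep_ta.
    have P2 : rep (setv (F i) x i) (wr m1 (ta 0) (m1 (va 0) - m1 (va x))).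
      exact: rep_ta.
    case: (IH _ _ _ Cc W P2) => m2 [R2 P3].
    rewrite V0 -/b in R2.
    have Exx : m2 (va x) = i.
      by case: P3 => [_ -> //] _; rewrite run_var // setvE.
    case: (IHj i.+1 (wr (wr (wr m2 (ta 0) 1) (va x) i.+1) (ta 0) 0)) => [| |m' [R3 P4]].
    + by lia.
    + by apply: rep_ta => //; apply: rep_va => //; apply: rep_ta.
    exists m'; split=> //.
    have -> : j.+1 * (b + 6) + 2 = (b + (4 + (j * (b + 6) + 2))).+2 by lia.
    rewrite addn1; rstep; apply: reach_skip; first by eassumption.
      by rewrite wrE !R1 // V0 setvE; lia.
    have -> : p.+3 = p + 3 by lia.
    apply: reach_trans R2 _.
    do 3 rstep; apply: reach_jump; first by eassumption.
      by rewrite wrE.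
    by rewrite wrE wr_ta_va // Exx (addn1 i).
  case: (loop N 0 (wr m (va x) 0)) => [| |m' [R3 P4]].
  + by [].
  + exact: rep_va.
  exists m'; split=> //.
  have -> : N * (b + 6) + 3 = (N * (b + 6) + 2).+1 by lia.
  by rstep; rewrite -(addn1 p).
Qed.

(** A while loop, kept outside the language so that every command has polynomial cost. [comp_w_ok]
    charges its body a bound independent of [N]. *)
Definition comp_w (p x : nat) (c : cmd) :=
  IJz (va x) (p + len_c c + 3) :: comp_c p.+1 c ++ [:: IConst (ta 0) 0; IJz (ta 0) p].

Lemma size_comp_w p x c : size (comp_w p x c) = len_c c + 3.
Proof. by rewrite /= size_cat size_comp_c /= addn2 addn3. Qed.

Lemma comp_w_ok P p x c j s m b :
  code_at P p (comp_w p x c) -> wf_c c -> x < NV -> rep s m ->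
  (forall N, bnd_c c N <= b) ->
  (forall i, i < j -> var (iter i (run c) s) x != 0) ->
  var (iter j (run c) s) x = 0 ->
  exists m', reach P (j * (b + 3) + 1) (RS p m) (RS (p + (len_c c + 3)) m') /\
             rep (iter j (run c) s) m'.
Proof.
move=> C W Wx + B; rewrite /comp_w in C.
case/code_at_cons: C => C0 /code_at_cat [C1]; rewrite size_comp_c.
case/code_at_cons=> C2 /code_at_cons [C3 _].
elim: j s m => [|j IH] s m R Hi Hj.
  exists m; split=> //; apply: (reach_jump C0); first by case: R => _ -> //.
  by rewrite addnA; apply: reach0.
case: (comp_c_ok C1 W R) => m1 [R1 P1].
case: (IH (run c s) (wr m1 (ta 0) 0)) => [|i Hij| |m' [R2 P2]].
- exact: rep_ta.
- by rewrite -iterSr; apply: Hi.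
- by rewrite -iterSr.
exists m'; split; last by rewrite iterSr.
have -> : j.+1 * (b + 3) + 1 = (b + (j * (b + 3) + 1).+2).+1 by lia.
apply: (reach_skip C0); first by case: R => _ -> // _; apply: (Hi 0).
apply: reach_trans (reach_le (B _) R1) _.
rstep; apply: (reach_jump C3); first by rewrite wrE.
exact: R2.
Qed.

(** * Polynomial bounds for all commands *)

Definition poly_bnd (f : nat -> nat) := exists K d, forall N, f N <= K * N.+1 ^ d.

Lemma poly_const a : poly_bnd (fun=> a).
Proof. by exists a, 0 => N; rewrite muln1. Qed.

Lemma poly_add f g : poly_bnd f -> poly_bnd g -> poly_bnd (fun N => f N + g N).
Proof.
case=> K [d H] [K' [d' H']]; exists (K + K'), (maxn d d') => N.
rewrite mulnDl; apply: leq_add.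
  by apply: leq_trans (H N) _; rewrite leq_mul2l leq_pexp2l ?leq_maxl ?orbT.
by apply: leq_trans (H' N) _; rewrite leq_mul2l leq_pexp2l ?leq_maxr ?orbT.
Qed.

Lemma poly_mulN f : poly_bnd f -> poly_bnd (fun N => N * f N).
Proof.
case=> K [d H]; exists K, d.+1 => N.
by rewrite expnS mulnCA; apply: leq_mul.
Qed.

Lemma bnd_e_poly e : poly_bnd (bnd_e e).
Proof.
elim: e => [c|x|a IHa b IHb|a IHa b IHb|a e IH|x e IH] /=;
  by repeat first [exact: poly_const | assumption | apply: poly_add | apply: poly_mulN].
Qed.

Lemma bnd_c_poly c : poly_bnd (bnd_c c).
Proof.
elim: c => [x e|a i e|c1 IH1 c2 IH2|e c1 IH1 c2 IH2|x c IH] /=;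
  by repeat first [exact: poly_const | assumption | exact: bnd_e_poly
                  | apply: poly_add | apply: poly_mulN].
Qed.

(** * Relocation of the input into array 0 *)

Definition boot_save i k := flatten [seq [:: IAdd 0 0 1; IStore 0 j] | j <- iota i k].

(* Continues the copy with the cells from address 82 up to B; the jump targets are
   absolute, and 2560 = 32 * 80 undoes the increments of boot_save. *)
Definition boot_copy : seq instr :=
  [:: IConst 2 82; IConst 3 2560; ISub 3 0 3; IConst 4 1;
      ISub 5 3 2; IJz 5 184; ILoad 5 2; IAdd 0 0 1; IStore 0 5; IAdd 2 2 4;
      IConst 5 0; IJz 5 176;
      IConst 5 0; IAdd 1 3 5; ILoad 2 1].

(* The input occupies all low addresses, so register 0 (its length, scaled up
   to a base address B) is the only free cell to start the relocation with. *)
Definition boot : seq instr :=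
  nseq 10 (IAdd 0 0 0) ++ [:: IStore 0 1; IConst 1 32] ++ boot_save 2 80 ++ boot_copy.

(** Input entry [j] starts in cell [j.+1], so [i] is the next cell to copy and register 0 is the
    last address written. *)
Definition saved inp B i (m : nat -> nat) :=
  [/\ m 0 = B + 32 * (i - 2), m 1 = 32,
      forall j, j < i.-1 -> m (B + 32 * j) = nth 0 inp j
    & forall j, i <= j.+1 -> j.+1 < B -> m j.+1 = nth 0 inp j].

Lemma boot_double_ok P p k m : code_at P p (nseq k (IAdd 0 0 0)) ->
  exists m', [/\ reach P k (RS p m) (RS (p + k) m'), m' 0 = 2 ^ k * m 0
                & forall j, m' j.+1 = m j.+1].
Proof.
elim: k p m => [|k IH] p m C.
  by exists m; split; rewrite ?addn0 ?mul1n //; apply: reach0.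
case/code_at_cons: C => C1 C; case: (IH _ (wr m 0 (m 0 + m 0)) C) => m' [R E K].
exists m'; split=> //; first by rstep; rewrite addnS -addSn.
by rewrite E wrE expnS; lia.
Qed.

Lemma boot_save_ok P p i k inp B m :
  code_at P p (boot_save i k) -> 2 <= i -> i + k <= B -> saved inp B i m ->
  exists m', reach P (2 * k) (RS p m) (RS (p + 2 * k) m') /\ saved inp B (i + k) m'.
Proof.
elim: k p i m => [|k IH] p i m C Hi HB S.
  by exists m; rewrite !addn0; split=> //; apply: reach0.
case/code_at_cons: C => C1 /code_at_cons [C2 C].
case: S => S0 S1 S2 S3.
pose m1 := wr m 0 (m 0 + m 1); pose m2 := wr m1 (m1 0) (m1 i).
case: (IH _ i.+1 m2 C) => [| | |m' [R S']]; try lia.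
- have E0 : m1 0 = B + 32 * i.-1 by rewrite /m1 wrE S0 S1; lia.
  have Ei : m1 i = nth 0 inp i.-1.
    by rewrite /m1 /wr; case: eqP => [|_]; [lia|rewrite -{1}(@prednK i) ?S3 //; lia].
  rewrite /m2 E0 Ei; split.
  + rewrite /wr; case: eqP => [|_]; [lia|rewrite E0; lia].
  + rewrite /wr; case: eqP => [|_]; [lia|by []].
  + move=> j Hj; rewrite /wr; case: eqP => [Ej|ne]; first by have -> : i.-1 = j by lia.
    rewrite /m1 /wr; case: eqP => [|_]; [lia|apply: S2; lia].
  + move=> j Hj Hj'; rewrite /wr; case: eqP => [|_]; first by lia.
    by rewrite /m1 /wr /=; apply: S3; lia.
exists m'; split; last by rewrite addnS -addSn.
have -> : 2 * k.+1 = (2 * k).+2 by lia.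
rstep; rstep; have -> : p + (2 * k).+2 = p.+2 + 2 * k by lia.
exact: R.
Qed.

Definition copying inp B i m := [/\ m 2 = i, m 3 = B & m 4 = 1] /\ saved inp B i m.

Lemma boot_ok P inp : code_at P 0 boot -> 0 < size inp ->
  exists s m, [/\ reach P (8 * (1024 * size inp) + 300) (init inp) (RS 187 m), rep s m,
                 var s 0 = nth 0 inp 0 & forall j, j < size inp -> arr s 0 j = nth 0 inp j].
Proof.
move=> C N0; set N := size inp in N0 *.
case/code_at_cat: C => Ca; rewrite size_nseq.
case/code_at_cons=> C1 /code_at_cons [C2] /code_at_cat [Cb].
have -> : 0 + 10 = 10 by [].
have -> : 12 + size (boot_save 2 80) = 172 by vm_compute.
rewrite /boot_copy; do 15 (case/code_at_cons => ?); move=> _.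
case: (boot_double_ok (Defs.mem (init inp)) Ca) => m1 [R1 E1 K1].
(* Ten doublings put [B] above the 82 registers and above all input cells. The length itself is
   lost, so copying continues up to [B]; cells past the input hold 0, the default value of [nth]. *)
set B := 2 ^ 10 * N.
have BE : B = 1024 * N by [].
have HB : 82 < B by lia.
have {}E1 : m1 0 = B by rewrite E1.
pose m2 := wr (wr m1 (m1 0) (m1 1)) 1 32.
have S2 : saved inp B 2 m2.
  rewrite /m2 E1; split.
  + by rewrite /wr /=; case: eqP => [|_]; [lia|rewrite E1; lia].
  + by rewrite wrE.
  + case=> // _; rewrite /wr muln0 addn0; case: eqP => [|_]; first by lia.
    by rewrite eqxx K1.
  + by case=> // j _ Hj; rewrite /wr /=; case: eqP => [|_]; [lia|rewrite K1].
case: (boot_save_ok Cb _ _ S2) => [||m3 [R3 S3]]; try lia.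
have loop : forall j i m, 82 <= i -> i + j = B -> copying inp B i m ->
  exists m', reach P (8 * j + 2) (RS 176 m) (RS 184 m') /\
    [/\ m' 3 = B & forall j, j < B.-1 -> m' (B + 32 * j) = nth 0 inp j].
  elim=> [|j IHj] i m Hi Hij [[H2 H3 H4] [H0 H1 Hs Hr]].
    exists (wr m 5 (m 3 - m 2)); split.
      rstep; apply: reach_jump; first by eassumption.
        by rewrite wrE H3 H2; lia.
      exact: reach0.
    split; first by [].
    by move=> l Hl; rewrite /wr; case: eqP => [|_]; [lia|apply: Hs; lia].
  have Ei : m i = nth 0 inp i.-1 by rewrite -{1}(@prednK i) ?Hr //; lia.
  case: (IHj i.+1 (wr (wr (wr (wr (wr (wr m 5 (B - i)) 5 (nth 0 inp i.-1)) 0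
    (B + 32 * i.-1)) (B + 32 * i.-1) (nth 0 inp i.-1)) 2 i.+1) 5 0)) => [| | |m' [R' H']]; try lia.
    have nB x : x < 82 -> (x == B + 32 * i.-1) = false by move=> ?; apply/eqP; lia.
    split; first by rewrite /wr /= !nB.
    split; rewrite /wr /= ?nB //.
    + lia.
    + move=> l Hl; case: eqP => [|_]; first by lia.
      case: eqP => [|_]; first by lia.
      case: eqP => [El|ne]; first by have -> : i.-1 = l by lia.
      repeat (case: eqP => [|_]; first by lia).
      by apply: Hs; lia.
    + move=> l Hl Hl'.
      repeat (case: eqP => [|_]; first by lia).
      by apply: Hr; lia.
  exists m'; split=> //.
  have -> : 8 * j.+1 + 2 = (8 * j + 2).+4.+4 by lia.
  rstep; apply: reach_skip; first by eassumption.
    by rewrite wrE H3 H2; lia.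
  do 5 rstep; apply: reach_jump; first by eassumption.
    by rewrite wrE.
  move: R'; rewrite /wr /=.
  have nB x : x < 82 -> (x == B + 32 * i.-1) = false by move=> ?; apply/eqP; lia.
  have n5 : (i == 5) = false by apply/eqP; lia.
  rewrite H0 H1 H2 H3 H4.
  have -> : B + 32 * (i - 2) + 32 = B + 32 * i.-1 by lia.
  by rewrite n5 Ei !nB // (addn1 i).
pose m4 := wr (wr (wr (wr m3 2 82) 3 2560) 3 (wr (wr m3 2 82) 3 2560 0 - wr (wr m3 2 82) 3 2560 3)) 4 1.
case: S3 => S0 S1 Ss Sr.
case: (loop (B - 82) 82 m4) => [| | |m5 [R5 [E5 H5]]]; try lia.
  split; first by rewrite /m4 /wr /= S0; split=> //; lia.
  split; rewrite /m4 /wr //=.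
  + by move=> l Hl; repeat (case: eqP => [|_]; first by lia); apply: Ss.
  + by move=> l Hl Hl'; repeat (case: eqP => [|_]; first by lia); apply: Sr.
pose m6 := wr (wr m5 5 0) 1 (wr m5 5 0 3 + wr m5 5 0 5).
pose m7 := wr m6 2 (m6 (m6 1)).
have HN : N <= B.-1 by rewrite BE; lia.
clearbody B.
have E61 : m6 1 = B by rewrite /m6 wrE /wr /= addn0.
have E71 : m7 1 = B by [].
have A6 j : j < B.-1 -> m6 (B + 32 * j) = nth 0 inp j.
  by move=> Hj; rewrite /m6 /wr; do 2 (case: eqP => [|_]; first by lia); apply: H5.
have A7 j : j < B.-1 -> m7 (B + 32 * j) = nth 0 inp j.
  by move=> Hj; rewrite -A6 // /m7 {1}/wr; case: eqP => [|_] //; lia.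
exists (St (fun x => m7 (va x)) (fun a i => m7 (m7 1 + 32 * i + a))), m7.
split.
- have -> : init inp = RS 0 (Defs.mem (init inp)) by [].
  apply: (@reach_le _ (10 + (2 + (160 + (4 + (8 * (B - 82) + 2 + 3)))))).
    by rewrite -/N BE; lia.
  apply: reach_trans R1 _; rstep; rstep; apply: reach_trans R3 _.
  do 4 rstep; apply: reach_trans R5 _; do 3 rstep.
  exact: reach0.
- by split=> //; rewrite E71; apply: ltnW.
- rewrite /= {1}/m7 wrE E61 -A6 ?muln0 ?addn0 //; lia.
- by move=> j Hj; rewrite /= addn0 E71 A7 //; lia.
Qed.

(** * Similar parts of a labelled graph *)

Lemma sum_bool (T : finType) (P : pred T) : \sum_(i : T) P i = #|[set i | P i]|.
Proof. by rewrite big_mkcond -sum1dep_card [RHS]big_mkcond; apply: eq_bigr => i _; case: (P i). Qed.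

Section Types.
Variables (n : nat) (G : graph n) (D : pred 'I_n) (lab : 'I_n -> nat).

Definition pos (v : 'I_n) : nat := \sum_(u < n) ((u < v) && (lab u == lab v)).
Definition csize (l : nat) : nat := \sum_(u < n) (lab u == l).

(* The order isomorphism between the parts labelled l1 and l2 preserves adjacency
   inside the parts and adjacency to D. *)
Definition similar (l1 l2 : nat) : bool :=
  (csize l1 == csize l2) &&
  [forall u : 'I_n, forall u' : 'I_n,
    [&& lab u == l1, lab u' == l2 & pos u == pos u'] ==>
    [&& ~~ D u, ~~ D u', [forall d : 'I_n, D d ==> (adj G u d == adj G u' d)]
      & [forall w : 'I_n, forall w' : 'I_n,
          [&& lab w == l1, lab w' == l2 & pos w == pos w'] ==>
          (adj G u w == adj G u' w')]]].

(** Rank at most d singles out the first d+1 parts of each class. A part with a vertex of [D] is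
    similar to no part, so it has rank 0 and is always explored. *)
Definition rank (l : nat) : nat := \sum_(m < n) ((m < l) && similar m l).

Hypothesis lab_lt : forall v, lab v < n.

Lemma posE v : pos v = #|[set u : 'I_n | (u < v) && (lab u == lab v)]|.
Proof. exact: sum_bool. Qed.

Lemma csizeE l : csize l = #|[set u : 'I_n | lab u == l]|.
Proof. exact: sum_bool. Qed.

Lemma pos_lt v : pos v < csize (lab v).
Proof.
rewrite posE csizeE; apply: proper_card; apply/properP; split.
  by apply/subsetP=> u; rewrite !inE => /andP [].
by exists v; rewrite !inE ?eqxx // ltnn.
Qed.

Lemma pos_mono u v : lab u = lab v -> u < v -> pos u < pos v.
Proof.
move=> E lt; rewrite !posE; apply: proper_card; apply/properP; split.
  by apply/subsetP=> w; rewrite !inE E => /andP [/ltn_trans/(_ lt) -> ->].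
by exists u; rewrite !inE ?lt ?E ?eqxx // ltnn.
Qed.

Lemma pos_inj u v : lab u = lab v -> pos u = pos v -> u = v.
Proof.
move=> E P; apply/val_inj; case: (ltngtP (val u) (val v)) => // lt.
  by have := pos_mono E lt; rewrite P ltnn.
by have := pos_mono (esym E) lt; rewrite P ltnn.
Qed.

(** [pos] is injective from a part into an ordinal of the same cardinality, hence onto. *)
Lemma pos_ex l p : p < csize l -> exists2 u, lab u = l & pos u = p.
Proof.
move=> Hp.
pose A := [set u : 'I_n | lab u == l].
pose f (u : 'I_n) : 'I_(csize l) := insubd (Ordinal Hp) (pos u).
have fE u : u \in A -> f u = pos u :> nat.
  by rewrite inE => /eqP E; have lt := pos_lt u; rewrite E in lt; rewrite /f val_insubd lt.
have inj : {in A &, injective f}.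
  move=> u v uA vA /(congr1 val); rewrite /= !fE //.
  by move: uA vA; rewrite !inE => /eqP uA /eqP vA; apply: pos_inj; rewrite uA vA.
have full : f @: A = setT.
  by apply/eqP; rewrite eqEcard subsetT cardsT card_ord card_in_imset // csizeE leqnn.
have : Ordinal Hp \in f @: A by rewrite full inE.
case/imsetP=> u uA Eu; exists u; first by move: uA; rewrite inE => /eqP.
by rewrite -fE // -Eu.
Qed.

Lemma similarP l1 l2 : reflect
  [/\ csize l1 = csize l2,
      (forall u u', lab u = l1 -> lab u' = l2 -> pos u = pos u' -> ~~ D u /\ ~~ D u'),
      (forall u u' d, lab u = l1 -> lab u' = l2 -> pos u = pos u' -> D d ->
         adj G u d = adj G u' d)
    & (forall u u' w w', lab u = l1 -> lab u' = l2 -> pos u = pos u' ->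
         lab w = l1 -> lab w' = l2 -> pos w = pos w' -> adj G u w = adj G u' w')]
  (similar l1 l2).
Proof.
apply: (iffP andP) => [[/eqP E /forallP H]|[E H1 H2 H3]].
  have {}H u u' : lab u = l1 -> lab u' = l2 -> pos u = pos u' ->
     [&& ~~ D u, ~~ D u', [forall d : 'I_n, D d ==> (adj G u d == adj G u' d)]
      & [forall w : 'I_n, forall w' : 'I_n,
          [&& lab w == l1, lab w' == l2 & pos w == pos w'] ==>
          (adj G u w == adj G u' w')]].
    by move=> e1 e2 e3; have /forallP/(_ u') := H u; rewrite e1 e2 e3 !eqxx.
  split=> //.
  - by move=> u u' e1 e2 e3; case/and4P: (H _ _ e1 e2 e3).
  - move=> u u' d e1 e2 e3 Dd; case/and4P: (H _ _ e1 e2 e3) => _ _ /forallP/(_ d) + _.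
    by rewrite Dd => /eqP.
  - move=> u u' w w' e1 e2 e3 e4 e5 e6; case/and4P: (H _ _ e1 e2 e3) => _ _ _ /forallP/(_ w).
    by move/forallP/(_ w'); rewrite e4 e5 e6 !eqxx => /eqP.
split; first exact/eqP.
apply/forallP=> u; apply/forallP=> u'; apply/implyP=> /and3P [/eqP e1 /eqP e2 /eqP e3].
case: (H1 _ _ e1 e2 e3) => -> -> /=; apply/andP; split.
  by apply/forallP=> d; apply/implyP=> Dd; apply/eqP; apply: H2.
apply/forallP=> w; apply/forallP=> w'; apply/implyP=> /and3P [/eqP e4 /eqP e5 /eqP e6].
by apply/eqP; apply: H3.
Qed.

Lemma similar_sym l1 l2 : similar l1 l2 = similar l2 l1.
Proof.
suff H l l' : similar l l' -> similar l' l by apply/idP/idP; apply: H.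
case/similarP=> E H1 H2 H3; apply/similarP; split=> //.
- by move=> u u' e1 e2 e3; case: (H1 u' u).
- by move=> *; symmetry; apply: H2.
- by move=> *; symmetry; apply: H3.
Qed.

Lemma similar_ex l1 l2 u : similar l1 l2 -> lab u = l1 ->
  exists2 u', lab u' = l2 & pos u' = pos u.
Proof.
by case/similarP=> E _ _ _ El; apply: pos_ex; rewrite -E -El pos_lt.
Qed.

Lemma similar_trans l1 l2 l3 : similar l1 l2 -> similar l2 l3 -> similar l1 l3.
Proof.
move=> S12 S23.
case/similarP: (S12) => E12 A12 B12 C12; case/similarP: (S23) => E23 A23 B23 C23.
have M u u'' : lab u = l1 -> lab u'' = l3 -> pos u = pos u'' ->
   exists u', [/\ lab u' = l2, pos u = pos u' & pos u' = pos u''].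
  by move=> e1 e2 e3; case: (similar_ex S12 e1) => u' El Ep; exists u'; rewrite Ep.
apply/similarP; split; first by rewrite E12.
- move=> u u'' e1 e2 e3; case: (M _ _ e1 e2 e3) => u' [e4 e5 e6].
  by case: (A12 u u') => //; case: (A23 u' u'').
- move=> u u'' d e1 e2 e3 Dd; case: (M _ _ e1 e2 e3) => u' [e4 e5 e6].
  by rewrite (B12 u u') // (B23 u' u'').
- move=> u u'' w w'' e1 e2 e3 f1 f2 f3; case: (M _ _ e1 e2 e3) => u' [e4 e5 e6].
  case: (M _ _ f1 f2 f3) => w' [f4 f5 f6].
  by rewrite (C12 u u' w w') // (C23 u' u'' w' w'').
Qed.

Hypothesis lab_edge : forall u v, adj G u v -> ~~ D u -> ~~ D v -> lab u = lab v.

(** Exchange the vertices at equal positions and fix everything else. By [lab_edge] an edge leaving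
    one of the two parts ends in [D], and similarity preserves such edges as well as the inner
    ones. *)
Lemma swap_ex l1 l2 : similar l1 l2 -> l1 != l2 ->
  exists f : 'I_n -> 'I_n,
    [/\ involutive f, forall x y, adj G (f x) (f y) = adj G x y,
        forall x, lab x = l2 -> lab (f x) = l1
      & forall x, lab x != l1 -> lab x != l2 -> f x = x].
Proof.
move=> S12 ne; have S21 : similar l2 l1 by rewrite similar_sym.
pose at_ l x := if [pick u : 'I_n | (lab u == l) && (pos u == pos x)] is Some u then u else x.
pose f x := if lab x == l1 then at_ l2 x else if lab x == l2 then at_ l1 x else x.
have atE l l' x : similar l l' -> lab x = l -> lab (at_ l' x) = l' /\ pos (at_ l' x) = pos x.
  move=> S El; rewrite /at_; case: pickP => [u /andP [/eqP -> /eqP ->] //|H].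
  by case: (similar_ex S El) => u e1 e2; have := H u; rewrite e1 e2 !eqxx.
have ne' : (l2 == l1) = false by apply/negbTE; rewrite eq_sym.
have f1 x : lab x = l1 -> lab (f x) = l2 /\ pos (f x) = pos x.
  by move=> E; rewrite /f E eqxx; apply: atE S12 E.
have f2 x : lab x = l2 -> lab (f x) = l1 /\ pos (f x) = pos x.
  by move=> E; rewrite /f E eqxx ne'; apply: atE S21 E.
have f3 x : lab x != l1 -> lab x != l2 -> f x = x.
  by rewrite /f => /negbTE -> /negbTE ->.
case/similarP: (S12) => _ A12 B12 C12.
have D1 x : lab x = l1 -> ~~ D x.
  by move=> E; case: (f1 x E) => e1 e2; case: (A12 x (f x)).
have D2 x : lab x = l2 -> ~~ D x.
  by move=> E; case: (f2 x E) => e1 e2; case: (A12 (f x) x).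
have noedge x y : lab x != lab y -> ~~ D x -> ~~ D y -> adj G x y = false.
  by move=> nl Dx Dy; apply/negP => e; case/eqP: nl; apply: lab_edge.
have ne12 : l2 != l1 by rewrite ne'.
have three x : [\/ lab x = l1, lab x = l2 | lab x != l1 /\ lab x != l2].
  case: (lab x =P l1) => [E|N1]; first by constructor 1.
  by case: (lab x =P l2) => [E|N2]; [constructor 2|constructor 3].
have K1 x y : lab x = l1 -> lab y = l1 -> adj G (f x) (f y) = adj G x y.
  by move=> /[dup] ex /f1 [? ?] /[dup] ey /f1 [? ?]; symmetry; apply: C12.
have K2 x y : lab x = l2 -> lab y = l2 -> adj G (f x) (f y) = adj G x y.
  by move=> /[dup] ex /f2 [? ?] /[dup] ey /f2 [? ?]; apply: C12.
have K12 x y : lab x = l1 -> lab y = l2 -> adj G (f x) (f y) = adj G x y.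
  move=> /[dup] ex /f1 [lx _] /[dup] ey /f2 [ly _].
  by rewrite !noedge ?ex ?ey ?lx ?ly //; first [by apply: D1 | by apply: D2].
have K13 x y : lab x = l1 -> lab y != l1 /\ lab y != l2 -> adj G (f x) (f y) = adj G x y.
  move=> ex [y1 y2]; rewrite (f3 y) //; case: (f1 x ex) => lx px.
  case: (boolP (D y)) => Dy; first by symmetry; apply: B12.
  by rewrite !noedge ?ex ?lx //; first [by rewrite eq_sym | by apply: D1 | by apply: D2].
have K23 x y : lab x = l2 -> lab y != l1 /\ lab y != l2 -> adj G (f x) (f y) = adj G x y.
  move=> ex [y1 y2]; rewrite (f3 y) //; case: (f2 x ex) => lx px.
  case: (boolP (D y)) => Dy; first by apply: B12.
  by rewrite !noedge ?ex ?lx //; first [by rewrite eq_sym | by apply: D1 | by apply: D2].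
exists f; split=> //.
- move=> x; case: (three x) => [E|E|[E1 E2]].
  + case: (f1 x E) => E1 P1; case: (f2 _ E1) => E2 P2; apply: pos_inj.
      by rewrite E2.
    by rewrite P2.
  + case: (f2 x E) => E1 P1; case: (f1 _ E1) => E2 P2; apply: pos_inj.
      by rewrite E2.
    by rewrite P2.
  + by rewrite !f3.
- move=> x y; case: (three x) => Hx; case: (three y) => Hy.
  + exact: K1.
  + exact: K12.
  + exact: K13.
  + by rewrite adj_sym (adj_sym G x); apply: K12.
  + exact: K2.
  + exact: K23.
  + by rewrite adj_sym (adj_sym G x); apply: K13.
  + by rewrite adj_sym (adj_sym G x); apply: K23.
  + by case: Hx Hy => ? ? [? ?]; rewrite !f3.
- by move=> x /f2 [].
Qed.

(** As [f] is its own inverse, [f v] serves as witness in both directions, and injectivity settles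
    the equality atoms. *)
Lemma sat_auto (f : 'I_n -> 'I_n) phi env env' :
  involutive f -> (forall x y, adj G (f x) (f y) = adj G x y) ->
  (forall x, env' x = omap f (env x)) ->
  (sat G env phi <-> sat G env' phi).
Proof.
move=> fK fA; elim: phi env env' => [x y|x y|a IHa b IHb|a IH|x a IH] env env' E /=.
- by rewrite !E; case: (env x) => [u|] //=; case: (env y) => [v|] //=; rewrite fA.
- rewrite !E; case: (env x) => [u|] //=; case: (env y) => [v|] //=.
  by split=> [->|/(inv_inj fK)].
- by rewrite (IHa _ _ E) (IHb _ _ E).
- by rewrite (IH _ _ E).
- split=> [[v Hv]|[v Hv]]; exists (f v).
    have H y : upd env' x (f v) y = omap f (upd env x v y).
      by rewrite /upd; case: eqP.
    exact/(IH _ _ H).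
  have H y : upd env' x v y = omap f (upd env x (f v) y).
    by rewrite /upd; case: eqP => //= _; rewrite fK.
  exact/(IH _ _ H).
Qed.

(* At most size Z of the parts similar to that of v meet Z, so v can be
   exchanged with a vertex of an untouched part of smaller label. *)
Lemma sat_small_rank Z phi env x v :
  (forall y u, env y = Some u -> u \in Z) ->
  (forall u, u \in Z -> rank (lab u) < size Z) ->
  sat G (upd env x v) phi ->
  exists2 w, rank (lab w) <= size Z & sat G (upd env x w) phi.
Proof.
move=> HZ HR; elim/(@ltn_ind): {v}(lab v) {-2}v (erefl (lab v)) => l IH v El Hv.
case: (leqP (rank l) (size Z)) => [le|lt]; first by exists v; rewrite ?El.
pose A := [set m : 'I_n | (m < l) && similar m l].
have cA : size Z < #|A| by rewrite -sum_bool.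
have [m mA mZ] : exists2 m : 'I_n, m \in A & m \notin [seq Ordinal (lab_lt u) | u <- Z].
  apply/exists_inP; rewrite -[X in is_true X]negbK negb_exists_in; apply/negP => /forall_inP H.
  have : #|A| <= size [seq Ordinal (lab_lt u) | u <- Z].
    apply: leq_trans (card_size _); apply: subset_leq_card; apply/subsetP => m mA.
    by have := H m mA; rewrite negbK.
  by rewrite size_map leqNgt cA.
have {mA} [ml ms] : m < l /\ similar m l by move: mA; rewrite inE => /andP [].
have nml : val m != l by rewrite neq_ltn ml.
case: (swap_ex ms nml) => f [fK fA f2 f3].
apply: (IH m ml (f v) (f2 v El)).
(* The swap fixes all of [Z]: no vertex of [Z] lies in the untouched part [m], and none in part [l],
   whose rank exceeds [size Z]. So only the value of [x] changes. *)
apply: (proj1 (@sat_auto f phi (upd env x v) _ fK fA _)); last exact: Hv.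
move=> y; rewrite /upd; case: eqP => //= _; case Ey: (env y) => [u|] //=.
have uZ := HZ _ _ Ey.
rewrite f3 //; first by apply: contra mZ => /eqP E; apply/mapP; exists u => //; apply/val_inj.
by apply: contraTneq (HR u uZ) => ->; rewrite -leqNgt ltnW.
Qed.

Lemma card_rank_le d :
  #|[set v : 'I_n | rank (lab v) <= d]| <= d.+1 * #|[set v : 'I_n | rank (lab v) == 0]|.
Proof.
(* v is determined by its rank and by the vertex at the same position in the
   first part similar to its own *)
have ex v : exists u, [&& rank (lab u) == 0, pos u == pos v &
                         (lab u == lab v) || similar (lab u) (lab v)].
  elim/(@ltn_ind): {v}(lab v) {-2}v (erefl (lab v)) => l IH v El.
  case: (posnP (rank l)) => [E0|]; first by exists v; rewrite El E0 !eqxx.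
  rewrite /rank sum_bool => /card_gt0P [m]; rewrite inE => /andP [ml ms].
  have [w Ew Pw] : exists2 w, lab w = m & pos w = pos v.
    by apply: similar_ex El; rewrite similar_sym.
  case: (IH m ml w Ew) => u /and3P [Ru /eqP Pu Su].
  exists u; rewrite Ru Pu Pw eqxx El /=.
  case/orP: Su => [/eqP ->|Su]; first by rewrite Ew ms orbT.
  by rewrite (@similar_trans _ m) ?orbT // -?Ew.
pose g v := xchoose (ex v).
have gP v : [&& rank (lab (g v)) == 0, pos (g v) == pos v &
               (lab (g v) == lab v) || similar (lab (g v)) (lab v)] := xchooseP (ex v).
pose h v : 'I_d.+1 * 'I_n := (inord (rank (lab v)), g v).
have inj : {in [set v : 'I_n | rank (lab v) <= d] &, injective h}.
  move=> v w; rewrite !inE => rv rw [/(congr1 val)]; rewrite /= !inordK // => Er Eg.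
  case/and3P: (gP v) => _ /eqP pv sv; case/and3P: (gP w) => _ /eqP pw sw.
  have {}Eg : g w = g v by rewrite Eg.
  rewrite Eg in pw sw.
  apply: pos_inj; last by rewrite -pv pw.
  apply/eqP; apply/negP => /negP nl.
  have S : similar (lab v) (lab w).
    case/orP: sv => sv; case/orP: sw => sw.
    - by rewrite -(eqP sv) (eqP sw) eqxx in nl.
    - by rewrite -(eqP sv).
    - by rewrite -(eqP sw) similar_sym.
    - by apply: similar_trans sw; rewrite similar_sym.
  have mono a b : lab a < lab b -> similar (lab a) (lab b) -> rank (lab a) < rank (lab b).
    move=> lt S'; rewrite /rank !sum_bool; apply: proper_card; apply/properP; split.
      apply/subsetP => m; rewrite !inE => /andP [m1 m2].
      by rewrite (ltn_trans m1 lt) (similar_trans m2 S').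
    by exists (Ordinal (lab_lt a)); rewrite !inE /= ?lt ?S' // ltnn.
  case: (ltngtP (lab v) (lab w)) => C.
  - by have := mono _ _ C S; rewrite Er ltnn.
  - by rewrite similar_sym in S; have := mono _ _ C S; rewrite Er ltnn.
  - by rewrite C eqxx in nl.
rewrite -(card_in_imset inj).
have -> : d.+1 * #|[set v : 'I_n | rank (lab v) == 0]| =
  #|setX [set: 'I_d.+1] [set v : 'I_n | rank (lab v) == 0]| by rewrite cardsX cardsT card_ord.
apply: subset_leq_card; apply/subsetP => _ /imsetP [v _ ->].
by rewrite !inE /=; case/and3P: (gP v).
Qed.

End Types.

(** * Counting the vertices of rank 0 *)

Definition deg n (G : graph n) (v : 'I_n) : nat := \sum_(u < n) adj G v u.

Definition avoid_rel n (G : graph n) (D : pred 'I_n) : rel 'I_n :=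
  fun u v => [&& adj G u v, ~~ D u & ~~ D v].

Lemma integrity_witness n (G : graph n) :
  exists S : {set 'I_n}, #|S| + max_comp G S <= vertex_integrity G.
Proof.
rewrite /vertex_integrity.
suff H (r : seq {set 'I_n}) : (exists S : {set 'I_n}, #|S| + max_comp G S <= n) ->
   exists S : {set 'I_n}, #|S| + max_comp G S <=
      \big[minn/n]_(S0 <- r) (#|S0| + max_comp G S0).
  apply: H; exists setT; rewrite cardsT card_ord /max_comp big_pred0 ?addn0 //.
  by move=> x; rewrite !inE.
move=> H0; elim: r => [|S r IH]; first by rewrite big_nil.
rewrite big_cons; case: leqP => _ //.
by exists S.
Qed.

Lemma card_bigcup_le (I T : finType) (A : {set I}) (F : I -> {set T}) b :
  (forall i, i \in A -> #|F i| <= b) -> #|\bigcup_(i in A) F i| <= #|A| * b.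
Proof.
move=> H; rewrite -sum_nat_const.
elim/big_rec2: _ => [|i m X iA IH]; first by rewrite cards0.
apply: leq_trans (leq_card_setU _ _) _; apply: leq_add => //; exact: H.
Qed.

Definition highdeg n (G : graph n) (k : nat) : pred 'I_n := fun v => k <= deg G v.

Section Bound.
Variables (n : nat) (G : graph n) (k : nat) (lab : 'I_n -> nat).
Local Notation D := (highdeg G k).
Hypothesis lab_lt : forall v, lab v < n.
Hypothesis lab_edge : forall u v, adj G u v -> ~~ D u -> ~~ D v -> lab u = lab v.
Hypothesis lab_conn : forall u v, lab u = lab v -> connect (avoid_rel G D) u v.
Variable S : {set 'I_n}.
Hypothesis HS : #|S| + max_comp G S <= k.

Let cS (v : 'I_n) := [set y : 'I_n | connect (del_rel G S) v y].

Lemma card_cS v : v \notin S -> #|S| + #|cS v| <= k.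
Proof.
move=> vS; apply: leq_trans HS; rewrite leq_add2l.
by rewrite /max_comp; apply: (bigmax_sup v); rewrite ?inE.
Qed.

(** Outside [S], all neighbours of [v] lie in [S] or in the component of [v] minus [v] itself, which
    makes fewer than [k]. *)
Lemma D_sub_S v : D v -> v \in S.
Proof.
move=> Dv; apply/negPn/negP => vS; have := card_cS vS.
move: Dv; rewrite /highdeg /deg sum_bool => Dv.
have sub : [set u : 'I_n | adj G v u] \subset S :|: (cS v :\ v).
  apply/subsetP => u; rewrite !inE => e; case: (boolP (u \in S)) => //= uS.
  apply/andP; split; first by apply: contraTneq e => ->; rewrite adj_irr.
  by apply: connect1; rewrite /del_rel vS uS.
have vC : v \in cS v by rewrite inE connect0.
have Dv' := leq_trans Dv (leq_trans (subset_leq_card sub) (leq_card_setU _ _)).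
rewrite (cardsD1 v (cS v)) vC addnCA => /leq_trans/(_ Dv').
by rewrite add1n ltnn.
Qed.

Let B := [set v : 'I_n | ~~ D v & [exists s in S, lab s == lab v]].

(** Follow a path outside [D] from [v] to a vertex of [S] in its part. If [v] is not in [S], the
    vertex just before the first entry into [S] is a neighbour of some [s] in [S] outside [D], and
    [v] belongs to its component of G \ S. *)
Lemma B_cover : B \subset
  \bigcup_(s in [set s in S | ~~ D s])
     (s |: \bigcup_(u in [set u : 'I_n | adj G s u & u \notin S]) cS u).
Proof.
apply/subsetP => v; rewrite inE => /andP [Dv /exists_inP [s sS /eqP E]].
have /connectP [p] := lab_conn (esym E).
elim: p v Dv {E} => [|w p IH] v Dv /= pth El.
  apply/bigcupP; exists s; first by rewrite inE sS El.
  by rewrite El setU11.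
case/andP: pth => /and3P [e _ Dw] pth.
case: (boolP (v \in S)) => vS.
  by apply/bigcupP; exists v; rewrite ?inE ?vS // eqxx.
case: (boolP (w \in S)) => wS.
  apply/bigcupP; exists w; first by rewrite inE wS.
  rewrite inE; apply/orP; right; apply/bigcupP; exists v; last by rewrite inE connect0.
  by rewrite inE adj_sym e.
have /bigcupP [s0 s0S] := IH w Dw pth El.
rewrite !inE => /orP [/eqP ws0|/bigcupP [u uN wu]].
  by move: s0S; rewrite inE -ws0 (negbTE wS).
apply/bigcupP; exists s0 => //; rewrite inE; apply/orP; right.
apply/bigcupP; exists u => //; move: wu; rewrite !inE => wu.
apply: connect_trans wu _; apply: connect1.
by rewrite /del_rel vS wS adj_sym.
Qed.

(** Each of the at most [k] vertices of [S] outside [D] has degree below [k]; it contributes itself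
    and at most [k] components of at most [k] vertices. *)
Lemma card_B : #|B| <= k * (1 + k * k).
Proof.
apply: leq_trans (subset_leq_card B_cover) _.
have Sk : #|S| <= k by apply: leq_trans HS; apply: leq_addr.
apply: leq_trans (card_bigcup_le (b := 1 + k * k) _) _.
  move=> s; rewrite inE => /andP [_ Ds].
  apply: leq_trans (leq_card_setU _ _) _; rewrite cards1 leq_add2l.
  apply: leq_trans (card_bigcup_le (b := k) _) _.
    by move=> u; rewrite inE => /andP [_ /card_cS]; apply: leq_trans; apply: leq_addl.
  rewrite leq_mul2r; apply/orP; right.
  move: Ds; rewrite /highdeg /deg sum_bool -ltnNge => /ltnW; apply: leq_trans.
  by apply: subset_leq_card; apply/subsetP => u; rewrite !inE => /andP [].
rewrite leq_mul2r; apply/orP; right; apply: leq_trans Sk.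
by apply: subset_leq_card; apply/subsetP => u; rewrite !inE => /andP [].
Qed.

Let Z := [set v : 'I_n | [&& ~~ D v, ~~ [exists s in S, lab s == lab v] & rank G D lab (lab v) == 0]].

(** A part is connected; if it misses [S], it lies inside one component of G \ S. *)
Lemma csize_Z v : ~~ D v -> ~~ [exists s in S, lab s == lab v] -> csize lab (lab v) <= k.
Proof.
move=> Dv nS.
have {}nS u : lab u = lab v -> u \notin S.
  move=> E; apply: contra nS => uS; apply/exists_inP; exists u => //; exact/eqP.
apply: leq_trans (leq_trans (leq_addl _ _) (card_cS (nS v erefl))).
rewrite csizeE; apply: subset_leq_card; apply/subsetP => u; rewrite !inE => /eqP E.
have /connectP [p] := lab_conn (esym E).
elim: p {-2}v (erefl (lab v)) Dv {E} => [|w p IH] x Ex Dx /= pth El; first by rewrite El connect0.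
case/andP: pth => /and3P [e _ Dw] pth.
have Ew : lab w = lab v by rewrite -Ex; symmetry; apply: lab_edge.
apply: connect_trans (IH w Ew Dw pth El); apply: connect1.
by rewrite /del_rel !nS.
Qed.

(** Two adjacency tables describe a small part: position against position, and position against
    index in the enumeration of [D]. The ordinal has [k.+1] elements since [key] also stores the
    size of the part, which may be [k]. *)
Let inner l (p : 'I_k.+1 * 'I_k.+1) : bool :=
  [exists u : 'I_n, exists w : 'I_n,
    [&& lab u == l, lab w == l, pos lab u == p.1, pos lab w == p.2 & adj G u w]].
Let outer l (p : 'I_k.+1 * 'I_k.+1) : bool :=
  [exists u : 'I_n, exists d : 'I_n,
    [&& lab u == l, D d, pos lab u == p.1, index d (enum D) == p.2 & adj G u d]].
Let key (v : 'I_n) : ('I_k.+1 * 'I_k.+1) *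
    ({ffun 'I_k.+1 * 'I_k.+1 -> bool} * {ffun 'I_k.+1 * 'I_k.+1 -> bool}) :=
  ((inord (pos lab v), inord (csize lab (lab v))),
   ([ffun p => inner (lab v) p], [ffun p => outer (lab v) p])).

Lemma card_D : #|D| <= k.
Proof.
apply: leq_trans (leq_trans (leq_addr _ _) HS); apply: subset_leq_card.
by apply/subsetP => v; apply: D_sub_S.
Qed.

Lemma innerE u w : csize lab (lab u) <= k -> lab u = lab w ->
  inner (lab u) (inord (pos lab u), inord (pos lab w)) = adj G u w.
Proof.
move=> Hk E; have Hu := leq_trans (pos_lt lab u) Hk.
have Hw : pos lab w < k by apply: leq_trans (pos_lt lab w) _; rewrite -E.
apply/existsP/idP => [[u' /existsP [w']]|e].
  rewrite /= !inordK ?(leqW Hu) ?(leqW Hw) //.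
  case/and5P=> /eqP e1 /eqP e2 /eqP e3 /eqP e4.
  by rewrite (pos_inj e1 e3) (@pos_inj _ lab w' w) // e2.
exists u; apply/existsP; exists w.
by rewrite /= !inordK ?(leqW Hu) ?(leqW Hw) // E !eqxx.
Qed.

Lemma outerE u d : csize lab (lab u) <= k -> D d ->
  outer (lab u) (inord (pos lab u), inord (index d (enum D))) = adj G u d.
Proof.
move=> Hk Dd; have Hu := leq_trans (pos_lt lab u) Hk.
have Hd : index d (enum D) < k.
  by apply: leq_trans card_D; rewrite cardE index_mem mem_enum.
apply/existsP/idP => [[u' /existsP [d']]|e].
  rewrite /= !inordK ?(leqW Hu) ?(leqW Hd) //.
  case/and5P=> /eqP e1 Dd' /eqP e3 /eqP e4.
  rewrite (pos_inj e1 e3); suff -> : d' = d by [].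
  have id' : d' \in enum D by rewrite mem_enum.
  by rewrite -(nth_index d' id') e4 nth_index // mem_enum.
exists u; apply/existsP; exists d.
by rewrite /= !inordK ?(leqW Hu) ?(leqW Hd) // Dd !eqxx.
Qed.

Lemma key_similar u v : u \in Z -> v \in Z -> key u = key v ->
  similar G D lab (lab u) (lab v).
Proof.
rewrite !inE => /and3P [Du Su _] /and3P [Dv Sv _] [Ep Es /ffunP Ei /ffunP Eo].
have ku := csize_Z Du Su; have kv := csize_Z Dv Sv.
(* Vertices of [D] are isolated in [avoid_rel], so each of them is alone in its part. *)
have nD w l : lab w = lab l -> ~~ D l -> ~~ D w.
  move=> E Dl; have /connectP [[|x p] /=] := lab_conn E; first by move=> _ <-.
  by case/andP=> /and3P [].
apply/similarP; split.
- by move/(congr1 val): Es; rewrite /= !inordK.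
- by move=> x y ex ey _; split; [apply: nD ex Du|apply: nD ey Dv].
- move=> x y d ex ey exy Dd.
  rewrite -(outerE (u := x)) ?ex // -(outerE (u := y)) ?ey //.
  by have := Eo (inord (pos lab x), inord (index d (enum D))); rewrite !ffunE exy.
- move=> x y w z ex ey exy ew ez ewz.
  rewrite -(innerE (u := x)) ?ex // -(innerE (u := y)) ?ey //.
  by have := Ei (inord (pos lab x), inord (pos lab w)); rewrite !ffunE exy ewz.
Qed.

(** [key] is injective on [Z]: equal keys give similar parts, and if these were distinct, the one
    with the larger label would have positive rank. Within one part the position decides. *)
Lemma card_Z : #|Z| <= k.+1 * k.+1 * (2 ^ (k.+1 * k.+1) * 2 ^ (k.+1 * k.+1)).
Proof.
have inj : {in Z &, injective key}.
  move=> u v uZ vZ E; have S1 := key_similar uZ vZ E.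
  have S2 := key_similar vZ uZ (esym E).
  move: uZ vZ; rewrite !inE => /and3P [Du Su Ru] /and3P [Dv Sv Rv].
  have ku := csize_Z Du Su; have kv := csize_Z Dv Sv.
  have pu := leq_trans (pos_lt lab u) ku; have pv := leq_trans (pos_lt lab v) kv.
  case: E => /(congr1 val) Ep _ _ _; move: Ep.
  rewrite /= !inordK ?(leqW pu) ?(leqW pv) // => Ep.
  apply: pos_inj Ep; apply/eqP; apply/negP => /negP nl.
  have H a b : lab a < lab b -> similar G D lab (lab a) (lab b) ->
     rank G D lab (lab b) != 0.
    move=> lt Sab; rewrite -lt0n /rank sum_bool; apply/card_gt0P.
    by exists (Ordinal (lab_lt a)); rewrite inE /= lt.
  move: nl; rewrite neq_ltn => /orP [lt|lt].
    by have := H _ _ lt S1; rewrite Rv.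
  by have := H _ _ lt S2; rewrite Ru.
rewrite -(card_in_imset inj); apply: leq_trans (max_card _) _.
by rewrite !card_prod !card_ffun !card_prod card_bool !card_ord.
Qed.

Lemma card_rank0 : #|[set v : 'I_n | rank G D lab (lab v) == 0]| <=
  k + k * (1 + k * k) + k.+1 * k.+1 * (2 ^ (k.+1 * k.+1) * 2 ^ (k.+1 * k.+1)).
Proof.
have sub : [set v : 'I_n | rank G D lab (lab v) == 0] \subset [set v : 'I_n in D] :|: B :|: Z.
  apply/subsetP => v; rewrite !inE => Rv.
  have -> : (v \in D) = D v by [].
  by case: (D v) => //=; rewrite Rv andbT; case: [exists s in S, _].
apply: leq_trans (subset_leq_card sub) _.
apply: leq_trans (leq_card_setU _ _) _; apply: leq_add card_Z.
apply: leq_trans (leq_card_setU _ _) _; apply: leq_add card_B.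
by rewrite cardsE card_D.
Qed.

End Bound.

(** With X = k^2 + 1, each of the three summands is at most 2^(6X), since (k+1)^2 <= 2X; the
    remaining factor 2^(2X) is at least 4. *)
Lemma type_count k : k + k * (1 + k * k) +
  k.+1 * k.+1 * (2 ^ (k.+1 * k.+1) * 2 ^ (k.+1 * k.+1)) <= 2 ^ (8 * (k ^ 2 + 1)).
Proof.
have -> : k ^ 2 + 1 = (k * k).+1 by rewrite addn1.
set X := (k * k).+1.
have HX : X < 2 ^ X by apply: ltn_expl.
have X1 : 0 < X by [].
have kX : k < X + 1 by rewrite /X; nia.
have k2 : k.+1 * k.+1 <= 2 * X by rewrite /X; nia.
have A1 : k <= 2 ^ (6 * X).
  by apply: leq_trans (_ : X <= _); [lia|apply: leq_trans (ltnW HX) _; rewrite leq_exp2l //; lia].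
have A2 : k * (1 + k * k) <= 2 ^ (6 * X).
  apply: leq_trans (_ : X * X <= _); first by rewrite add1n -/X leq_mul2r; lia.
  apply: leq_trans (leq_mul (ltnW HX) (ltnW HX)) _.
  by rewrite -expnD leq_exp2l //; lia.
have A3 : k.+1 * k.+1 * (2 ^ (k.+1 * k.+1) * 2 ^ (k.+1 * k.+1)) <= 2 ^ (6 * X).
  have H : 2 ^ (k.+1 * k.+1) <= 2 ^ (2 * X) by rewrite leq_exp2l.
  have H2 : 2 * X <= 2 ^ (2 * X) by apply: ltnW; apply: ltn_expl.
  apply: leq_trans (leq_mul (leq_trans k2 H2) (leq_mul H H)) _.
  by rewrite -!expnD leq_exp2l //; lia.
have -> : 8 * X = 6 * X + 2 * X by lia.
rewrite expnD.
have A4 : 2 ^ 2 <= 2 ^ (2 * X) by rewrite leq_exp2l //; lia.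
apply: leq_trans (_ : 2 ^ (6 * X) * 4 <= _); first by lia.
by rewrite leq_mul2l A4 orbT.
Qed.

(** * Computing component types *)

(** Any nonzero number counts as true. Truncated subtraction from 1 negates, and negating twice
    normalises to 0 or 1. *)
Definition ENot e := ESub (EC 1) e.
Definition EBool e := ENot (ENot e).
Definition EAnd a b := ENot (EAdd (ENot a) (ENot b)).
Definition EImp a b := EBool (EAdd (ENot a) b).
Definition EEq a b := ENot (EAdd (ESub a b) (ESub b a)).
Definition ELt a b := EBool (ESub b a).
Definition EAll x e := ENot (ESum x (ENot e)).

Lemma eval_not e s : eval (ENot e) s = (eval e s == 0).
Proof. by rewrite /ENot /=; case: (eval e s). Qed.

Opaque ENot.

Lemma eval_bool e s : eval (EBool e) s = (0 < eval e s).
Proof. by rewrite /EBool !eval_not; case: (eval e s). Qed.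

Lemma eval_and a b s : eval (EAnd a b) s = (0 < eval a s) && (0 < eval b s).
Proof. by rewrite /EAnd eval_not /= !eval_not; case: (eval a s); case: (eval b s). Qed.

Lemma eval_imp a b s : eval (EImp a b) s = (0 < eval a s) ==> (0 < eval b s).
Proof. by rewrite /EImp eval_bool /= !eval_not; case: (eval a s); case: (eval b s). Qed.

Lemma eval_eq a b s : eval (EEq a b) s = (eval a s == eval b s).
Proof. by rewrite /EEq eval_not /= addn_eq0 -eqn_leq. Qed.

Lemma eval_lt a b s : eval (ELt a b) s = (eval a s < eval b s).
Proof. by rewrite /ELt eval_bool /= subn_gt0. Qed.

(* Rewriting with evalE must not see through EAll, whose body is again an ENot. *)
Definition eval_forall x e s := eval (EAll x e) s.

Lemma eval_all x e s : eval (EAll x e) s = eval_forall x e s.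
Proof. by []. Qed.

Lemma eval_forallE x e s n (P : pred 'I_n) : var s 0 = n ->
  (forall i : 'I_n, (0 < eval e (setv s x i)) = P i) ->
  (0 < eval_forall x e s) = [forall i, P i].
Proof.
move=> E; subst n => H; rewrite -[RHS]lt0b; congr (_ < _).
rewrite /eval_forall /EAll eval_not /= sum_nat_eq0; congr nat_of_bool.
by apply: eq_forallb => i; rewrite eval_not -H; case: (eval e _).
Qed.

Lemma eval_sum x e s n (F : 'I_n -> nat) : var s 0 = n ->
  (forall i : 'I_n, eval e (setv s x i) = F i) ->
  eval (ESum x e) s = \sum_(i < n) F i.
Proof. by move=> E; subst n => H /=; apply: eq_bigr. Qed.

Lemma run_if e c1 c2 s :
  run (CIf e c1 c2) s = if 0 < eval e s then run c1 s else run c2 s.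
Proof. by rewrite /=; case: (eval e s). Qed.

Lemma run_for x c s : run (CFor x c) s =
  setv (iteri (var s 0) (fun i s' => run c (setv s' x i)) s) x (var s 0).
Proof. by []. Qed.

Lemma run_seq c1 c2 s : run (CSeq c1 c2) s = run c2 (run c1 s).
Proof. by []. Qed.

Definition evalE :=
  (eval_imp, eval_lt, eval_eq, eval_and, eval_all, eval_bool, eval_not, lt0b).

Opaque EBool EAnd EImp EEq ELt EAll eval_forall.

Fixpoint reads (e : expr) (a : nat) : bool :=
  match e with
  | EC _ | EV _ => false
  | EAdd e1 e2 | ESub e1 e2 => reads e1 a || reads e2 a
  | EA b e => eqn a b || reads e a
  | ESum _ e => reads e a
  end.

Lemma eval_frame e s s' :
  (forall x, var s x = var s' x) ->
  (forall a, reads e a -> arr s a =1 arr s' a) -> eval e s = eval e s'.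
Proof.
elim: e s s' => [c|x|a IHa b IHb|a IHa b IHb|a e IH|x e IH] s s' V A //=.
- by rewrite (IHa s s') ?(IHb s s') // => c H; apply: A; rewrite /= H ?orbT.
- by rewrite (IHa s s') ?(IHb s s') // => c H; apply: A; rewrite /= H ?orbT.
- rewrite (IH s s') // => [|c H]; last by apply: A; rewrite /= H orbT.
  by apply: A; rewrite /= (_ : eqn a a) //; apply: eqxx.
- rewrite V; apply: eq_bigr => i _; apply: IH => //= y.
  by rewrite V.
Qed.

Lemma iteri_ind (T : Type) (I : nat -> T -> Prop) n f (s : T) :
  I 0 s -> (forall i s, i < n -> I i s -> I i.+1 (f i s)) -> I n (iteri n f s).
Proof.
move=> I0 IS; have : n <= n by []; elim: {-2}n => //= m IH lt.
by apply: IS => //; apply: IH; apply: ltnW.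
Qed.

(** As [e] does not read the array being filled, every entry is computed as in the initial state. *)
Lemma run_fill x a e s i : 0 < x -> ~~ reads e a -> i < var s 0 ->
  arr (run (CFor x (CSt a (EV x) e)) s) a i = eval e (setv s x i).
Proof.
move=> x0 nr /=.
pose I m s' := [/\ forall y, y != x -> var s' y = var s y,
   forall b, b != a -> arr s' b = arr s b &
   forall i, i < m -> arr s' a i = eval e (setv s x i)].
set f := fun (i : nat) (s' : state) => _.
suff: I (var s 0) (iteri (var s 0) f s) by case=> _ _ H; apply: H.
apply: iteri_ind; first by split.
move=> m s' _ [H1 H2 H3]; rewrite /f /=.
have refl b : eqn b b = true by exact: eqxx.
have E : eval e (setv s' x m) = eval e (setv s x m).
  apply: eval_frame => [y|b Hb] /=.
    by case: eqnP => // /eqP ne; rewrite H1.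
  by rewrite H2 //; apply: contraNneq nr => <-.
split=> /=.
- by move=> y ne; rewrite [eqn _ _](negbTE ne) H1.
- by move=> b ne; rewrite [eqn _ _](negbTE ne) H2.
- move=> j; rewrite refl refl ltnS leq_eqVlt => /orP [/eqP ->|lt].
    by rewrite eqxx.
  by rewrite ltn_eqF // H3.
Qed.


Local Notation V := EV.

(* Arrays: 0 input, 1 offsets of the rows of the adjacency matrix, 2 membership in D,
   3 labels, 4 positions, 5 ranks of the labels, 6 ranks of the vertices for the best
   threshold so far, 7 vertices sorted by rank, 8 number of vertices of rank <= d.
   Variables: 1 threshold, 18 smallest number of vertices of rank 0, 19 the same
   for the current threshold, 20 length of array 7, 21 position in the input. *)
Definition eadj x y := EA 0 (EAdd (EA 1 x) y).
Definition ecsize x := ESum 10 (EEq (EA 3 (V 10)) x).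
Definition ematch u w x y :=
  EAnd (EEq (EA 3 u) x) (EAnd (EEq (EA 3 w) y) (EEq (EA 4 u) (EA 4 w))).
Definition esim x y :=
  EAnd (EEq (ecsize x) (ecsize y))
    (EAll 13 (EAll 14 (EImp (ematch (V 13) (V 14) x y)
      (EAnd (ENot (EA 2 (V 13))) (EAnd (ENot (EA 2 (V 14)))
        (EAnd (EAll 15 (EImp (EA 2 (V 15)) (EEq (eadj (V 13) (V 15)) (eadj (V 14) (V 15)))))
           (EAll 16 (EAll 17 (EImp (ematch (V 16) (V 17) x y)
              (EEq (eadj (V 13) (V 16)) (eadj (V 14) (V 17)))))))))))).

Definition CSkip := CSet 7 (EC 0).
(** The language has no product, so row offsets are accumulated. Variable 21 ends at 1 + n * n,
    where the formula begins. *)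
Definition p_off := CSeq (CSet 21 (EC 1))
  (CFor 2 (CSeq (CSt 1 (V 2) (V 21)) (CSet 21 (EAdd (V 21) (V 0))))).
(** The strict test turns index t into threshold t + 1, so the loop over 0..n-1 tries the thresholds
    1..n, the possible values of the vertex integrity. *)
Definition p_deg := CFor 2 (CSt 2 (V 2) (ELt (V 1) (ESum 10 (eadj (V 2) (V 10))))).
Definition p_lab0 := CFor 2 (CSt 3 (V 2) (V 2)).
Definition p_relab := CFor 6 (CIf (EEq (EA 3 (V 6)) (V 5)) (CSt 3 (V 6) (V 4)) CSkip).
(** Components by merging: for each edge outside [D], one label replaces the other everywhere. Both
    labels are first copied to variables, because [p_relab] overwrites the array they come from. *)
Definition p_lab := CFor 2 (CFor 3
  (CIf (EAnd (eadj (V 2) (V 3)) (ENot (EAdd (EA 2 (V 2)) (EA 2 (V 3)))))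
       (CSeq (CSet 4 (EA 3 (V 2))) (CSeq (CSet 5 (EA 3 (V 3))) p_relab)) CSkip)).
Definition p_pos := CFor 2 (CSt 4 (V 2)
  (ESum 10 (EAnd (ELt (V 10) (V 2)) (EEq (EA 3 (V 10)) (EA 3 (V 2)))))).
Definition p_rank := CFor 12 (CSt 5 (V 12)
  (ESum 11 (EAnd (ELt (V 11) (V 12)) (esim (V 11) (V 12))))).
Definition p_count := CSet 19 (ESum 10 (EEq (EA 5 (EA 3 (V 10))) (EC 0))).
Definition p_save := CFor 2 (CSt 6 (V 2) (EA 5 (EA 3 (V 2)))).
Definition p_types :=
  CSeq p_deg (CSeq p_lab0 (CSeq p_lab (CSeq p_pos (CSeq p_rank p_count)))).
(** The initial value n + 1 exceeds every count, so the first threshold is always accepted. *)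
Definition p_best := CSeq (CSet 18 (EAdd (V 0) (EC 1)))
  (CFor 1 (CSeq p_types (CIf (ELt (V 19) (V 18)) (CSeq (CSet 18 (V 19)) p_save) CSkip))).
(** Sorting by rank makes the candidates of each depth a prefix of array 7, so that a depth only
    needs one length. *)
Definition p_list := CSeq (CSet 20 (EC 0))
  (CFor 12 (CSeq
     (CFor 2 (CIf (EEq (EA 6 (V 2)) (V 12))
        (CSeq (CSt 7 (V 20) (V 2)) (CSet 20 (EAdd (V 20) (EC 1)))) CSkip))
     (CSt 8 (V 12) (V 20)))).
(** The registers may still contain input data after the relocation, so even zeros have to be
    set. *)
Definition p_init := CSeq (CSet 22 (EC 0)) (CSeq (CSet 23 (EC 0)) (CSeq (CSet 24 (EC 0)) (CSet 27 (EC 1)))).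
Definition p_kernel := CSeq p_off (CSeq p_best (CSeq p_list p_init)).

Lemma wf_kernel : wf_c p_kernel.
Proof. by vm_compute. Qed.

Section Kernel.
Variables (n : nat) (G : graph n).

Definition base (s : state) :=
  var s 0 = n /\ forall x y : 'I_n, arr s 0 (arr s 1 x + y) = adj G x y.

Lemma base_run c s : wf_c c -> ~~ stores c 0 -> ~~ stores c 1 -> base s -> base (run c s).
Proof.
move=> W S0 S1 [Bn Ba]; split; first by rewrite run_var // wf_writes0.
by move=> x y; rewrite !run_arr.
Qed.

Lemma p_off_ok s : var s 0 = n -> (forall x y : 'I_n, arr s 0 (1 + x * n + y) = adj G x y) ->
  base (run p_off s) /\ var (run p_off s) 21 = 1 + n * n.
Proof.
move=> Hn Ha.
pose I m s' := [/\ var s' 0 = n, var s' 21 = 1 + m * n, arr s' 0 = arr s 0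
  & forall i, i < m -> arr s' 1 i = 1 + i * n].
rewrite /p_off /= Hn; set f := fun (i : nat) (s' : state) => _.
suff: I n (iteri n f (setv s 21 1)).
  case=> [I1 I2 I3 I4]; split=> //; split=> // x y /=.
  by rewrite I3 I4.
apply: iteri_ind; first by split=> //=; rewrite mul0n.
move=> i s' _ [I1 I2 I3 I4]; rewrite /f /=; split=> //=.
  by rewrite I2 I1 mulSn; lia.
move=> j; rewrite ltnS leq_eqVlt => /orP [/eqP ->|lt]; first by rewrite eqxx.
by rewrite ltn_eqF // I4.
Qed.

Lemma eval_adj x y s (u v : 'I_n) : base s -> eval x s = u -> eval y s = v ->
  eval (eadj x y) s = adj G u v.
Proof. by case=> _ H /= -> ->; rewrite H. Qed.

Lemma base_setv s x v : 0 < x -> base s -> base (setv s x v).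
Proof. by case: x => // x _ [H1 H2]. Qed.

Lemma p_deg_ok s (v : 'I_n) : base s ->
  arr (run p_deg s) 2 v = highdeg G (var s 1).+1 v.
Proof.
move=> Bs; rewrite run_fill //; last by case: Bs => ->.
rewrite evalE /highdeg /deg (eval_sum (n := n) (F := fun u => adj G v u)) //.
  by case: Bs.
by move=> i; apply: eval_adj => //; do 2 apply: base_setv => //.
Qed.

(** The parts are exactly the components of G \ D, together with each vertex of [D] as a part of its
    own. *)
Definition good_lab k (lab : 'I_n -> nat) :=
  [/\ forall v, lab v < n,
      forall u v, adj G u v -> ~~ highdeg G k u -> ~~ highdeg G k v -> lab u = lab v
    & forall u v, lab u = lab v -> connect (avoid_rel G (highdeg G k)) u v].

Lemma p_relab_ok s i : i < var s 0 ->
  arr (run p_relab s) 3 i = if arr s 3 i == var s 5 then var s 4 else arr s 3 i.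
Proof.
move=> Hi; rewrite /p_relab.
pose I m s' := [/\ var s' 4 = var s 4, var s' 5 = var s 5,
  forall i, i < m -> arr s' 3 i = if arr s 3 i == var s 5 then var s 4 else arr s 3 i
  & forall i, m <= i -> arr s' 3 i = arr s 3 i].
suff: I (var s 0) (run p_relab s) by case=> _ _ H _; apply: H.
rewrite /p_relab run_for; set f := fun (i : nat) (s' : state) => _.
suff: I (var s 0) (iteri (var s 0) f s) by [].
apply: iteri_ind; first by split.
move=> m s' _ [I1 I2 I3 I4]; rewrite /f run_if !evalE /= I2 I4 //.
case: eqP => [E|ne] /=; split=> //= j.
- rewrite ltnS leq_eqVlt => /orP [/eqP ->|lt]; first by rewrite eqxx E eqxx.
  by rewrite ltn_eqF // I3.
- by move=> lt; rewrite gtn_eqF // I4 // ltnW.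
- rewrite ltnS leq_eqVlt => /orP [/eqP ->|lt]; last by rewrite I3.
  by rewrite I4 //; case: eqP.
- by move=> lt; rewrite I4 // ltnW.
Qed.

Let Rel k : rel 'I_n := avoid_rel G (highdeg G k).

Lemma avoid_sym k : connect_sym (Rel k).
Proof.
apply: sym_connect_sym => u v; rewrite /Rel /avoid_rel adj_sym.
by case: adj; rewrite //= andbC.
Qed.

(** In the invariant [ok Q], equal labels imply connectedness, and the edges among the pairs in [Q],
    those already visited, have equally labelled ends. Relabelling merges classes and never splits
    one, so a single pass suffices. *)
Lemma p_lab_ok s k : base s -> (forall v : 'I_n, arr s 2 v = highdeg G k v) ->
  good_lab k (fun v => arr (run (CSeq p_lab0 p_lab) s) 3 v).
Proof.
move=> Bs HD; rewrite /p_lab; set inner := CFor 3 _.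
pose ok (Q : rel 'I_n) s' := [/\ base s', arr s' 2 = arr s 2,
  forall v : 'I_n, arr s' 3 v < n,
  forall u v : 'I_n, arr s' 3 u = arr s' 3 v -> connect (Rel k) u v
  & forall u v : 'I_n, Q u v -> Rel k u v -> arr s' 3 u = arr s' 3 v].
have okv Q x v s' : 0 < x -> ok Q s' -> ok Q (setv s' x v).
  by move=> x0 [O1 O2 O3 O4 O5]; split=> //; apply: base_setv.
have ok0 : ok (fun _ _ => false) (run p_lab0 s).
  have E (v : 'I_n) : arr (run p_lab0 s) 3 v = v.
    by rewrite run_fill //; case: Bs => ->.
  split=> //.
  - by apply: base_run Bs.
  - by rewrite run_arr.
  - by move=> v; rewrite E.
  - by move=> u v; rewrite !E => /val_inj ->; apply: connect0.
have okin s' (u : 'I_n) Q : ok Q s' -> var s' 2 = u ->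
   ok (fun x y => Q x y || (x == u)) (run inner s') .
  move=> O Eu.
  suff: ok (fun x y => Q x y || (x == u) && (y < n)) (run inner s').
    case=> O1 O2 O3 O4 O5; split=> // x y H; apply: O5; move: H.
    by rewrite ltn_ord andbT.
  case: (O) => [[On _] _ _ _ _].
  rewrite /inner run_for On; set f := fun (i : nat) (s' : state) => _; apply: (okv) => //.
  pose J m s'' := ok (fun x y : 'I_n => Q x y || (x == u) && (y < m)) s'' /\ var s'' 2 = u.
  suff: J n (iteri n f s') by case.
  apply: iteri_ind.
    split=> //; case: O => O1 O2 O3 O4 O5; split=> // x y.
    by rewrite andbF orbF; apply: O5.
  move=> m s1 Hm [O' Eu']; pose v : 'I_n := Ordinal Hm.
  have {O'} O1 := okv _ 3 m _ isT O'; rewrite /f.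
  move: (setv s1 3 m) O1 (Eu' : var (setv s1 3 m) 2 = u) (erefl : var (setv s1 3 m) 3 = v).
  move=> s2 {Eu' s1} [B2 D2 L2 C2 E2] Eu2 Ev2.
  have D2' w : arr s2 2 w = arr s 2 w by rewrite D2.
  have Ea : eval (eadj (V 2) (V 3)) s2 = adj G u v by apply: eval_adj.
  rewrite run_if !evalE Ea !evalE; case: ifP; last first.
    rewrite [eval (EAdd _ _) _]/= Eu2 Ev2 !D2' !(HD u, HD v) => Hr.
    split=> //; apply: (okv) => //; split=> // x y /orP [HQ|/andP [/eqP ->]]; first by apply: E2; rewrite HQ.
    rewrite ltnS leq_eqVlt => /orP [/eqP Ey|lt]; last by apply: E2; rewrite eqxx lt orbT.
    have {Ey} -> : y = v by apply: val_inj.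
    rewrite /Rel /avoid_rel; move: Hr.
    by case: adj => //=; case: (highdeg G k u) => //; case: (highdeg G k v).
  rewrite [eval (EAdd _ _) _]/= Eu2 Ev2 !D2' !(HD u, HD v) => Hr.
  rewrite !run_seq [run (CSet 4 _) _]/= [run (CSet 5 _) _]/=.
  have {Hr} Ruv : Rel k u v.
    rewrite /Rel /avoid_rel; move: Hr.
    by case: adj => //=; case: (highdeg G k u) => //; case: (highdeg G k v).
  set s3 := setv _ 5 _.
  have B3 : base s3 by do 2 apply: base_setv => //.
  have Er (w : 'I_n) : arr (run p_relab s3) 3 w =
      if arr s2 3 w == arr s2 3 v then arr s2 3 u else arr s2 3 w.
    rewrite p_relab_ok; last by case: B3 => ->.
    by rewrite /s3 /= Ev2 Eu2.
  split; last by rewrite run_var // /s3.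
  split.
  - by apply: base_run B3.
  - by rewrite run_arr // /s3.
  - by move=> w; rewrite Er; case: ifP.
  - have Cuv : connect (Rel k) u v by apply: connect1.
    move=> x y; rewrite !Er; case: eqP => [Ex|nx]; case: eqP => [Ey|ny].
    + by move=> _; apply: C2; rewrite Ex.
    + move/C2; apply: connect_trans; rewrite avoid_sym; apply: connect_trans Cuv _.
      by rewrite avoid_sym; apply: C2.
    + move/C2/connect_trans; apply; apply: connect_trans Cuv _.
      by rewrite avoid_sym; apply: C2.
    + by move/C2.
  - move=> x y H R; rewrite !Er; case/orP: H => [H|/andP [/eqP Ex]].
      by rewrite (E2 x y) ?H.
    rewrite ltnS leq_eqVlt => /orP [/eqP Ey|lt]; last by rewrite (E2 x y) // Ex eqxx lt orbT.
    have -> : y = v by apply: val_inj.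
    by rewrite Ex eqxx; case: ifP.
suff: ok (fun x y => x < n) (run (CSeq p_lab0 (CFor 2 inner)) s).
  case=> O1 O2 O3 O4 O5; split=> // u v e Du Dv.
  by apply: O5 => //; rewrite /Rel /avoid_rel e Du.
case: (ok0) => [[On _] _ _ _ _].
rewrite run_seq run_for On; set f := fun (i : nat) (s' : state) => _; apply: (okv) => //.
apply: (@iteri_ind _ (fun m s1 => ok (fun x y => x < m) s1)) => // m s1 Hm O.
pose u : 'I_n := Ordinal Hm.
have Om := okv _ 2 m _ isT O.
case: (okin _ u _ Om erefl) => O1 O2 O3 O4 O5.
split=> // x y; rewrite ltnS leq_eqVlt => H; apply: O5.
by rewrite orbC -val_eqE.
Qed.

Definition rank0 k lab := #|[set v : 'I_n | rank G (highdeg G k) lab (lab v) == 0]|.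

Lemma eval_sim s (D : pred 'I_n) (lab : 'I_n -> nat) :
  base s -> (forall v : 'I_n, arr s 2 v = D v) ->
  (forall v : 'I_n, arr s 3 v = lab v) -> (forall v : 'I_n, arr s 4 v = pos lab v) ->
  eval (esim (V 11) (V 12)) s = similar G D lab (var s 11) (var s 12).
Proof.
move=> Bs H2 H3 H4; have [Hn _] := Bs.
have Es1 : eval (ecsize (V 11)) s = csize lab (var s 11).
  by apply: eval_sum => // i; rewrite evalE /= H3.
have Es2 : eval (ecsize (V 12)) s = csize lab (var s 12).
  by apply: eval_sum => // i; rewrite evalE /= H3.
rewrite /esim !evalE Es1 Es2 /similar; congr (nat_of_bool (_ && _)).
rewrite ?eval_all; apply: eval_forallE => // u; set s1 := setv s 13 u.
have B1 : base s1 by apply: base_setv.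
rewrite ?eval_all; apply: eval_forallE => // u'; set s2 := setv s1 14 u'.
have B2 : base s2 by apply: base_setv.
rewrite !evalE; set A1 := eval_forall 15 _ _; set A2 := eval_forall 16 _ _.
rewrite /s2 /s1 /= !(H2, H3, H4) !eqb0 -/s1 -/s2 {}/A1 {}/A2.
congr (_ ==> (_ && (_ && (_ && _)))).
- apply: eval_forallE => // d; set s3 := setv s2 15 d.
  have B3 : base s3 by apply: base_setv.
  have E1 : eval (eadj (V 13) (V 15)) s3 = adj G u d by apply: eval_adj.
  have E2 : eval (eadj (V 14) (V 15)) s3 = adj G u' d by apply: eval_adj.
  rewrite !evalE E1 E2 /s3 /s2 /s1 /= H2 lt0b.
  by case: adj; case: adj.
- apply: eval_forallE => // w; set s3 := setv s2 16 w; rewrite eval_all.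
  apply: eval_forallE => // w'; set s4 := setv s3 17 w'.
  have B4 : base s4 by do 2 apply: base_setv => //.
  have E1 : eval (eadj (V 13) (V 16)) s4 = adj G u w by apply: eval_adj.
  have E2 : eval (eadj (V 14) (V 17)) s4 = adj G u' w' by apply: eval_adj.
  rewrite !evalE E1 E2.
  rewrite /s4 /s3 /s2 /s1 /= !(H3, H4).
  by case: adj; case: adj.
Qed.

Lemma p_types_ok s : base s -> let s' := run p_types s in
  exists lab, [/\ good_lab (var s 1).+1 lab, forall v : 'I_n, arr s' 3 v = lab v,
    forall l, l < n -> arr s' 5 l = rank G (highdeg G (var s 1).+1) lab l
    & var s' 19 = rank0 (var s 1).+1 lab].
Proof.
move=> Bs; set k := (var s 1).+1.
have -> : run p_types s = run p_count (run p_rank (run p_pos (run (CSeq p_lab0 p_lab) (run p_deg s)))) by [].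
set s1 := run p_deg s; set s2 := run (CSeq p_lab0 p_lab) s1.
have B1 : base s1 by apply: base_run.
have B2 : base s2 by apply: base_run.
have D1 (v : 'I_n) : arr s1 2 v = highdeg G k v by apply: p_deg_ok.
pose lab (v : 'I_n) := arr s2 3 v; exists lab.
have good : good_lab k lab by apply: p_lab_ok.
have D2 (v : 'I_n) : arr s2 2 v = highdeg G k v by rewrite run_arr.
set s3 := run p_pos s2.
have B3 : base s3 by apply: base_run.
have P3 (v : 'I_n) : arr s3 4 v = pos lab v.
  rewrite run_fill //; last by case: B2 => ->.
  apply: eval_sum; first by case: B2.
  by move=> i; rewrite !evalE.
have L3 (v : 'I_n) : arr s3 3 v = lab v by rewrite run_arr.
have D3 (v : 'I_n) : arr s3 2 v = highdeg G k v by rewrite run_arr.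
set s4 := run p_rank s3.
have B4 : base s4 by apply: base_run.
have R4 l : l < n -> arr s4 5 l = rank G (highdeg G k) lab l.
  move=> Hl; rewrite run_fill //; last by case: B3 => ->.
  apply: eval_sum; first by case: B3.
  move=> i; rewrite eval_and eval_lt lt0b.
  by rewrite (@eval_sim _ (highdeg G k) lab) ?lt0b //; do 2 apply: base_setv => //.
have L4 (v : 'I_n) : arr s4 3 v = lab v by rewrite run_arr.
have [lab_lt _ _] := good.
split=> //.
transitivity (eval (ESum 10 (EEq (EA 5 (EA 3 (V 10))) (EC 0))) s4); first by [].
rewrite /rank0 -sum_bool; apply: eval_sum; first by case: B4.
by move=> v; rewrite eval_eq /= L4 R4.
Qed.

Lemma p_best_ok s : base s -> 0 < n -> let s' := run p_best s in
  base s' /\ exists k lab, [/\ good_lab k lab,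
    forall v : 'I_n, arr s' 6 v = rank G (highdeg G k) lab (lab v)
    & forall t, t < n -> exists2 lab', good_lab t.+1 lab' & rank0 k lab <= rank0 t.+1 lab'].
Proof.
move=> Bs n0 s'.
pose J t s' := [/\ base s', t = 0 -> var s' 18 = n + 1,
   0 < t -> exists k lab, [/\ good_lab k lab,
    forall v : 'I_n, arr s' 6 v = rank G (highdeg G k) lab (lab v) & var s' 18 = rank0 k lab]
   & forall t', t' < t -> exists2 lab', good_lab t'.+1 lab' & var s' 18 <= rank0 t'.+1 lab'].
have Jsetv t s1 x v : 0 < x -> eqn 18 x = false -> J t s1 -> J t (setv s1 x v).
  move=> x0 n18 [J1 J2 J3 J4]; split=> //=; rewrite ?n18 //; exact: base_setv.
suff: J n s'.
  case=> J1 _ /(_ n0) [k [lab [G1 G2 G3]]] J4; split=> //; exists k, lab; split=> // t Ht.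
  by rewrite -G3; apply: J4.
have [Hn _] := Bs.
rewrite /s' /p_best run_seq run_for [run (CSet 18 _) s]/= Hn.
rewrite [var (setv _ _ _) 0]/= Hn; set f := fun (i : nat) (s' : state) => _.
apply: (Jsetv) => //.
apply: (@iteri_ind _ J); first by split=> //; apply: base_setv.
move=> t s1 Ht [J1 J2 J3 J4]; rewrite /f run_seq run_if.
have B2 : base (setv s1 1 t) by apply: base_setv.
case: (p_types_ok B2); set s2 := run p_types _; rewrite [var _ 1]/= => lab [L1 L2 L3 L4].
have V18 : var s2 18 = var s1 18 by rewrite /s2 run_var.
have B3 : base s2 by apply: base_run.
have A6 : arr s2 6 = arr s1 6 by rewrite /s2 run_arr.
rewrite eval_lt lt0b.
have -> : eval (V 19) s2 = rank0 t.+1 lab by [].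
have -> : eval (V 18) s2 = var s1 18 by [].
case: ltnP => Hc.
  rewrite run_seq [run (CSet 18 _) _]/=.
  set s3 := setv s2 18 _.
  have B4 : base s3 by apply: base_setv.
  have E18 : var (run p_save s3) 18 = rank0 t.+1 lab by rewrite run_var //= L4.
  split=> //.
  - exact: base_run.
  - move=> _; exists t.+1, lab; split=> // v.
    rewrite run_fill //; last by case: B4 => ->.
    by rewrite /= L2 L3 //; case: L1.
  - move=> t'; rewrite E18 ltnS leq_eqVlt => /orP [/eqP ->|lt]; first by exists lab.
    by case: (J4 t' lt) => lab' g' le; exists lab' => //; apply: leq_trans le; apply: ltnW.
(* A rejection cannot happen in the first round: the count is at most [n], below the initial n +
   1. *)
have t0 : 0 < t.
  case: (posnP t) => // t0; move: Hc; rewrite J2 // /rank0 => Hc.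
  have := max_card [set v : 'I_n | rank G (highdeg G t.+1) lab (lab v) == 0].
  by rewrite card_ord => /(leq_trans Hc); rewrite addn1 ltnn.
rewrite [run CSkip _]/=; apply: (Jsetv) => //; split=> //.
- by move=> _; rewrite A6 V18; apply: J3.
- move=> t'; rewrite V18 ltnS leq_eqVlt => /orP [/eqP ->|lt]; first by exists lab.
  exact: J4.
Qed.
End Kernel.

(** * Sorting by rank and the candidates of each depth *)

Section Lists.
Variables (n : nat) (br : nat -> nat).

Definition by_rank r := flatten [seq [seq v <- iota 0 n | br v == i] | i <- iota 0 r].

Lemma by_rankS r : by_rank r.+1 = by_rank r ++ [seq v <- iota 0 n | br v == r].
Proof. by rewrite /by_rank -addn1 iotaD map_cat flatten_cat /= cats0. Qed.

Lemma by_rank_prefix r r' : r <= r' -> exists t, by_rank r' = by_rank r ++ t.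
Proof.
move/subnK <-; elim: (r' - r) => [|j [t IH]]; first by exists [::]; rewrite cats0.
by rewrite addSn by_rankS IH -catA; eexists.
Qed.

Lemma mem_by_rank r v : (v \in by_rank r) = (v < n) && (br v < r).
Proof.
elim: r => [|r IH]; first by rewrite /by_rank /= in_nil andbF.
rewrite by_rankS mem_cat IH mem_filter mem_iota add0n ltnS [br v <= r]leq_eqVlt.
by case: (v < n); rewrite ?andbF ?andbT //= orbC.
Qed.

Lemma size_by_rank r : size (by_rank r) = count (fun v => br v < r) (iota 0 n).
Proof.
elim: r => [|r IH]; first by rewrite (eq_count (a2 := pred0)) ?count_pred0.
rewrite by_rankS size_cat IH size_filter -count_predUI.
rewrite [X in _ + X](eq_count (a2 := pred0)) ?count_pred0 ?addn0; last first.
  by move=> v /=; case: ltngtP.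
by apply: eq_count => v /=; rewrite ltnS [RHS]leq_eqVlt orbC.
Qed.

Lemma p_list_ok s : var s 0 = n -> arr s 6 = br ->
  let s' := run p_list s in
  mkseq (arr s' 7) (size (by_rank n)) = by_rank n /\
  forall d, d < n -> arr s' 8 d = size (by_rank d.+1).
Proof.
move=> Hn Hb.
pose J r s' := [/\ var s' 0 = n, arr s' 6 = br,
  mkseq (arr s' 7) (var s' 20) = by_rank r
  & forall d, d < r -> arr s' 8 d = size (by_rank d.+1)].
rewrite /p_list run_seq run_for [var _ 0]/= Hn; set f := fun (i : nat) (s' : state) => _.
suff: J n (iteri n f (run (CSet 20 (EC 0)) s)).
  case=> J1 J2 J3 J4; split=> //.
  by rewrite -{1}J3 size_mkseq.
apply: (@iteri_ind _ J); first by split.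
move=> r s1 Hr [J1 J2 J3 J4]; rewrite /f run_seq run_for [var (setv _ _ _) 0]/= J1.
set g := fun (i : nat) (s' : state) => _.
pose K m s' := [/\ var s' 0 = n, arr s' 6 = br, var s' 12 = r, arr s' 8 = arr s1 8
  & mkseq (arr s' 7) (var s' 20) = by_rank r ++ [seq v <- iota 0 m | br v == r]].
have: K n (iteri n g (setv s1 12 r)).
  apply: (@iteri_ind _ K); first by split=> //=; rewrite cats0.
  move=> m s2 _ [K1 K2 K3 K4 K5]; rewrite /g run_if eval_eq lt0b /= K2 K3 /K.
  have -> : iota 0 m.+1 = iota 0 m ++ [:: m] by rewrite -addn1 iotaD.
  rewrite filter_cat catA -K5 /=.
  case: eqP => H /=; last by split=> //=; rewrite cats0.
  split=> //=; rewrite addn1 mkseqS eqxx cats1; congr rcons.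
  by apply/eq_in_map => j; rewrite mem_iota add0n => /andP [_ lt]; rewrite ltn_eqF.
case=> K1 K2 K3 K4 K5; split=> //=.
- by rewrite K5 by_rankS.
- move=> d; rewrite ltnS leq_eqVlt K3 => /orP [/eqP ->|lt].
    by rewrite eqxx by_rankS -K5 size_mkseq.
  by rewrite ltn_eqF // K4 J4.
Qed.

End Lists.

Section KernelSpec.
Variables (n : nat) (G : graph n).

(** Array 8 has [n] entries; as ranks are below [n], every vertex is a candidate at depth [n] or
    more. *)
Definition cands (s : state) d := if d < n then arr s 8 d else n.

Definition cand_spec (s : state) k lab :=
  let rk v := rank G (highdeg G k) lab (lab v) in
  forall d, [/\ forall j, j < cands s d -> exists2 v : 'I_n, arr s 7 j = v & rk v <= d,
                forall v, rk v <= d -> exists2 j, j < cands s d & arr s 7 j = v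
              & cands s d <= d.+1 * rank0 G k lab].

Lemma rank_lt D (lab : 'I_n -> nat) l : l < n -> rank G D lab l < n.
Proof.
move=> Hl; rewrite /rank sum_bool -[X in _ < X]card_ord; apply: proper_card.
apply/properP; split; first by apply/subsetP.
by exists (Ordinal Hl); rewrite ?inE //= ltnn.
Qed.

Lemma count_ord (P : pred nat) : count P (iota 0 n) = #|[set v : 'I_n | P v]|.
Proof.
have -> : iota 0 n = index_iota 0 n by rewrite /index_iota subn0.
rewrite -sum_bool -sum1_count big_mkcond big_mkord.
by apply: eq_bigr => i _; case: (P i).
Qed.

Lemma cand_spec_list s k lab : var s 0 = n -> good_lab G k lab ->
  (forall v : 'I_n, arr s 6 v = rank G (highdeg G k) lab (lab v)) ->
  cand_spec (run p_list s) k lab.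
Proof.
move=> Hn good Hr rk d; have [lt _ _] := good.
case: (p_list_ok Hn erefl); set s' := run _ _; set br := arr s 6 => H1 H2.
have {}Hr (v : 'I_n) : br v = rank G (highdeg G k) lab (lab v) := Hr v.
have brn (v : 'I_n) : br v < n by rewrite Hr rank_lt.
have sz : size (by_rank n br n) = n.
  rewrite size_by_rank count_ord -[RHS]card_ord -[RHS]cardsT; apply: eq_card => v.
  by rewrite !inE brn.
have Hc : cands s' d = size (by_rank n br (minn d.+1 n)).
  by rewrite /cands; case: ltnP => Hd; [rewrite H2 // (minn_idPl _)|rewrite (minn_idPr _) ?sz // ltnW].
have HL : mkseq (arr s' 7) (cands s' d) = by_rank n br (minn d.+1 n).
  case: (by_rank_prefix n br (geq_minr d.+1 n)) => t Et.
  have : take (cands s' d) (mkseq (arr s' 7) (size (by_rank n br n))) = by_rank n br (minn d.+1 n).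
    by rewrite H1 Et Hc take_size_cat.
  rewrite /mkseq -map_take take_iota (minn_idPl _) //.
  by rewrite Hc Et size_cat leq_addr.
have mem v : (v \in by_rank n br (minn d.+1 n)) = (v < n) && (br v <= d).
  rewrite mem_by_rank; case: (ltnP v n) => //= Hv.
  by rewrite leq_min (brn (Ordinal Hv)) andbT.
split.
- move=> j Hj; have : arr s' 7 j \in by_rank n br (minn d.+1 n).
    by rewrite -HL; apply/map_f; rewrite mem_iota.
  by rewrite mem => /andP [Hv]; exists (Ordinal Hv); rewrite // /rk -Hr.
- move=> v Hv; have : val v \in by_rank n br (minn d.+1 n) by rewrite mem ltn_ord Hr.
  rewrite -HL => /mapP [j]; rewrite mem_iota => /andP [_ Hj] ->; by exists j.
- apply: leq_trans (card_rank_le G (highdeg G k) lt d).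
  rewrite Hc size_by_rank count_ord; apply: subset_leq_card.
  by apply/subsetP => v; rewrite !inE Hr leq_min => /andP [].
Qed.

Lemma kernel_ok s : var s 0 = n -> (forall x y : 'I_n, arr s 0 (1 + x * n + y) = adj G x y) ->
  let s' := run p_kernel s in
  [/\ base G s', arr s' 0 = arr s 0, var s' 21 = 1 + n * n,
      [/\ var s' 22 = 0, var s' 23 = 0, var s' 24 = 0 & var s' 27 = 1]
    & 0 < n -> exists k lab, [/\ good_lab G k lab, cand_spec s' k lab
        & forall t, t < n -> exists2 lab', good_lab G t.+1 lab' &
            rank0 G k lab <= rank0 G t.+1 lab']].
Proof.
move=> Hn Ha s'.
have Es : s' = run p_init (run p_list (run p_best (run p_off s))) by [].
case: (p_off_ok Hn Ha); set s1 := run p_off s => B1 V1.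
split.
- by rewrite Es; do 3 (apply: base_run => //).
- by rewrite run_arr.
- by rewrite Es run_var // run_var // run_var.
- by [].
move=> n0; case: (p_best_ok B1 n0) => B2 [k [lab [good Hr Hmin]]].
exists k, lab; split=> //.
have := cand_spec_list (proj1 B2) good Hr.
set s3 := run p_list _ => C rk d.
have E8 : arr s' 8 = arr s3 8 by rewrite Es run_arr.
have E7 : arr s' 7 = arr s3 7 by rewrite Es run_arr.
by move: (C d); rewrite /cands E8 E7.
Qed.
End KernelSpec.

(** * The formula evaluator *)

(* Variables: 21 position in the formula, 22 stack height, 23 quantifier depth,
   24 mode (0 = evaluate, 1 = return), 25 returned value, 27 running.
   Arrays: 9 environment; 10-15 stack frames: kind, quantified variable, its
   previous value, index of the current candidate, accumulated disjunction,
   position of the body. *)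
Definition etok i := EA 0 (EAdd (V 21) (EC i)).
Definition eenv i := EA 9 (etok i).
Definition c_ret i := CSeq (CSet 21 (EAdd (V 21) (EC i))) (CSet 24 (EC 1)).
(** Frame kinds: 0 and 1 for a disjunction during its left and right side, 2 for a negation, 3 for a
    quantifier. [i] tokens are skipped. *)
Definition c_push t i := CSeq (CSt 10 (V 22) (EC t))
  (CSeq (CSet 22 (EAdd (V 22) (EC 1))) (CSet 21 (EAdd (V 21) (EC i)))).
Definition c_adj := CSeq (CSet 25 (EBool (eadj (eenv 1) (eenv 2)))) (c_ret 3).
Definition c_eq := CSeq (CSet 25 (EEq (eenv 1) (eenv 2))) (c_ret 3).
Definition c_or := c_push 0 1.
Definition c_not := c_push 2 1.
(** The old value of the variable is saved in the frame, since a quantifier may rebind a variable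
    used again after its scope. *)
Definition c_ex :=
  CSeq (CSt 11 (V 22) (etok 1)) (CSeq (CSt 12 (V 22) (eenv 1))
  (CSeq (CSt 13 (V 22) (EC 0)) (CSeq (CSt 14 (V 22) (EC 0))
  (CSeq (CSt 15 (V 22) (EAdd (V 21) (EC 2))) (CSeq (CSt 9 (etok 1) (EA 7 (EC 0)))
  (CSeq (CSet 23 (EAdd (V 23) (EC 1))) (c_push 3 2))))))).
Definition c_eval :=
  CIf (etok 0) (CIf (ESub (etok 0) (EC 1)) (CIf (ESub (etok 0) (EC 2))
    (CIf (ESub (etok 0) (EC 3)) c_ex c_not) c_or) c_eq) c_adj.
Definition c_or1 := CSeq (CSt 10 (V 8) (EC 1)) (CSeq (CSt 14 (V 8) (V 25)) (CSet 24 (EC 0))).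
Definition c_or2 := CSeq (CSet 25 (EBool (EAdd (EA 14 (V 8)) (V 25)))) (CSet 22 (V 8)).
Definition c_notr := CSeq (CSet 25 (ENot (V 25))) (CSet 22 (V 8)).
Definition c_next := CSeq (CSt 9 (EA 11 (V 8)) (EA 7 (EA 13 (V 8))))
  (CSeq (CSet 21 (EA 15 (V 8))) (CSet 24 (EC 0))).
(** The body has been evaluated at least once even if the graph has no vertex; the conjunction with
    [n] makes the answer false in that case. *)
Definition c_done := CSeq (CSet 25 (EAnd (EA 14 (V 8)) (V 0)))
  (CSeq (CSt 9 (EA 11 (V 8)) (EA 12 (V 8)))
  (CSeq (CSet 23 (ESub (V 23) (EC 1))) (CSet 22 (V 8)))).
Definition c_exr :=
  CSeq (CSt 14 (V 8) (EBool (EAdd (EA 14 (V 8)) (V 25))))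
  (CSeq (CSt 13 (V 8) (EAdd (EA 13 (V 8)) (EC 1)))
  (CSeq (CIf (ELt (ESub (V 23) (EC 1)) (V 0)) (CSet 9 (EA 8 (ESub (V 23) (EC 1)))) (CSet 9 (V 0)))
  (CIf (ELt (EA 13 (V 8)) (V 9)) c_next c_done))).
Definition c_return :=
  CIf (V 22) (CSeq (CSet 8 (ESub (V 22) (EC 1)))
    (CIf (EA 10 (V 8)) (CIf (ESub (EA 10 (V 8)) (EC 1))
      (CIf (ESub (EA 10 (V 8)) (EC 2)) c_exr c_notr) c_or2) c_or1))
  (CSet 27 (EC 0)).
Definition c_step := CIf (V 24) c_return c_eval.

Lemma wf_step : wf_c c_step.
Proof. by vm_compute. Qed.

Section Machine.
Variables (n : nat) (inp off L : nat -> nat) (cn : nat -> nat).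

(** What the machine computes. The range has at least one index because the end of the candidates is
    only tested after a round. *)
Fixpoint evl (e : nat -> nat) (d : nat) (f : form) : bool :=
  match f with
  | FAdj x y => 0 < inp (off (e x) + e y)
  | FEq x y => e x == e y
  | FOr f g => evl e d f || evl e d g
  | FNot f => ~~ evl e d f
  | FEx x f => (0 < n) && has (fun j => evl (fun y => if y == x then L j else e y) d.+1 f)
                              (iota 0 (maxn 1 (cn d)))
  end.

Fixpoint iters (d : nat) (f : form) : nat :=
  match f with
  | FAdj _ _ | FEq _ _ => 1
  | FOr f g => iters d f + iters d g + 3
  | FNot f => iters d f + 2
  | FEx _ f => maxn 1 (cn d) * (iters d.+1 f + 1) + 1
  end.

Definition static s := [/\ var s 0 = n, arr s 0 = inp, arr s 1 = off, arr s 7 = L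
  & forall d, cands n s d = cn d].

(** The flag stays 1 at all intermediate states, so the while loop does not stop early. *)
Definition evs j s s' :=
  iter j (run c_step) s = s' /\ forall i, i <= j -> var (iter i (run c_step) s) 27 = 1.

Lemma evs1 s : var s 27 = 1 -> var (run c_step s) 27 = 1 -> evs 1 s (run c_step s).
Proof. by move=> H H'; split=> // [[|[|i]]]. Qed.

Lemma evs_trans j j' s s' s'' : evs j s s' -> evs j' s' s'' -> evs (j + j') s s''.
Proof.
move=> [E H] [E' H']; split; first by rewrite addnC iterD E.
move=> i Hi; case: (leqP i j) => Hij; first exact: H.
rewrite -(subnK (ltnW Hij)) iterD E; apply: H'; lia.
Qed.

Definition same_below k s s' := forall a i, 10 <= a <= 15 -> i < k -> arr s' a i = arr s a i.

Definition at_eval s p sp d e := [/\ static s, var s 27 = 1,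
  [/\ var s 24 = 0, var s 21 = p, var s 22 = sp & var s 23 = d] & arr s 9 =1 e].

Definition at_ret s p sp d e v := [/\ static s, var s 27 = 1,
  [/\ var s 24 = 1, var s 21 = p, var s 22 = sp & var s 23 = d],
   var s 25 = nat_of_bool v & arr s 9 =1 e].

Definition code p (l : seq nat) := forall i, i < size l -> inp (p + i) = nth 0 l i.

Lemma code_cat p l1 l2 : code p (l1 ++ l2) -> code p l1 /\ code (p + size l1) l2.
Proof.
move=> H; split=> i Hi; first by rewrite H ?size_cat ?nth_cat ?Hi //; lia.
rewrite -addnA H ?size_cat ?nth_cat; last by lia.
by rewrite ltnNge leq_addr /= addKn.
Qed.

Lemma code_cons p x l : code p (x :: l) -> inp p = x /\ code p.+1 l.
Proof.
move=> H; split; first by have := H 0 isT; rewrite addn0.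
by move=> i Hi; rewrite addSnnS (H i.+1).
Qed.

Lemma step_eval s p sp d e t : at_eval s p sp d e -> inp p = t ->
  run c_step s = run (if t == 0 then c_adj else if t - 1 == 0 then c_eq else
    if t - 2 == 0 then c_or else if t - 3 == 0 then c_not else c_ex) s.
Proof.
move=> [[_ Ei _ _ _] _ [E24 E21 _ _] _] Et.
have T : eval (etok 0) s = t by rewrite /= Ei E21 addn0.
have S k : eval (ESub (etok 0) (EC k)) s = t - k by rewrite -T.
have E0 : eval (V 24) s = 0 by [].
rewrite /c_step run_if E0 /c_eval !run_if T !S.
by case: t {Et T S} => [|[|[|[|t]]]].
Qed.

Lemma step_ret s p sp d e v t : at_ret s p sp.+1 d e v -> arr s 10 sp = t ->
  run c_step s = run (if t == 0 then c_or1 else if t - 1 == 0 then c_or2 else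
    if t - 2 == 0 then c_notr else c_exr) (setv s 8 sp).
Proof.
move=> [_ _ [E24 _ E22 _] _ _] Et.
have E0 : eval (V 24) s = 1 by [].
have E1 : eval (V 22) s = sp.+1 by [].
have E8 : run (CSet 8 (ESub (V 22) (EC 1))) s = setv s 8 sp.
  by rewrite [LHS](_ : _ = setv s 8 (var s 22 - 1)) // E22 subn1.
have T : eval (EA 10 (V 8)) (setv s 8 sp) = t by [].
have S k : eval (ESub (EA 10 (V 8)) (EC k)) (setv s 8 sp) = t - k by rewrite -T.
rewrite /c_step run_if E0 /c_return run_if E1 run_seq E8 !run_if T !S.
by case: t {Et T S} => [|[|[|t]]].
Qed.

(** The induction works because a subformula returns with the stack height, depth and environment it
    was called with, and with the frames below intact: its caller finds its own frame unchanged. *)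
Lemma eval_ok f s p sp d e : code p (enc_form f) -> at_eval s p sp d e ->
  exists s' j, [/\ evs j s s', j <= iters d f,
     at_ret s' (p + size (enc_form f)) sp d e (evl e d f) & same_below sp s s'].
Proof.
elim: f s p sp d e => [x y|x y|f IHf g IHg|f IH|x f IH] s p sp d e /= C A.
- case/code_cons: C => C0 /code_cons [C1] /code_cons [C2 _].
  have E : run c_step s = run c_adj s := step_eval A C0.
  case: A => [St R [E24 E21 E22 E23] E9].
  exists (run c_step s), 1; split=> //.
  + by apply: evs1 => //; rewrite E.
  + rewrite E; split=> //.
    * by rewrite /= E21.
    * rewrite [LHS](_ : _ = eval (EBool (eadj (eenv 1) (eenv 2))) s) // eval_bool /=.
      case: St => _ -> -> _ _.
      by rewrite E21 !E9 addn1 C1 addn2 C2.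
  + by move=> a i _ _; rewrite E.
- case/code_cons: C => C0 /code_cons [C1] /code_cons [C2 _].
  have E : run c_step s = run c_eq s := step_eval A C0.
  case: A => [St R [E24 E21 E22 E23] E9].
  exists (run c_step s), 1; split=> //.
  + by apply: evs1 => //; rewrite E.
  + rewrite E; split=> //.
    * by rewrite /= E21.
    * rewrite [LHS](_ : _ = eval (EEq (eenv 1) (eenv 2)) s) // eval_eq /=.
      case: St => _ -> _ _ _.
      by rewrite E21 !E9 addn1 C1 addn2 C2.
  + by move=> a i _ _; rewrite E.
- case/code_cons: C => C0 /code_cat [C1 C2].
  have E : run c_step s = run c_or s := step_eval A C0.
  case: (A) => [St R [E24 E21 E22 E23] E9].
  set s1 := run c_step s in E.
  have A1 : at_eval s1 p.+1 sp.+1 d e.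
    rewrite E; split=> //.
    by rewrite /= E21 E22 !addn1.
  have T1 : arr s1 10 sp = 0 by rewrite E /= E22 eqxx.
  have K1 : same_below sp s s1.
    by move=> a i _ Hi; rewrite E /= E22 (ltn_eqF Hi) if_same.
  case: (IHf _ _ _ _ _ C1 A1) => s2 [j2 [R2 J2 A2 K2]].
  have T2 : arr s2 10 sp = 0 by rewrite K2.
  have E3 : run c_step s2 = run c_or1 (setv s2 8 sp) := step_ret A2 T2.
  set s3 := run c_step s2 in E3.
  case: (A2) => [St2 R2' [F24 F21 F22 F23] F25 F9].
  have A3 : at_eval s3 (p.+1 + size (enc_form f)) sp.+1 d e.
    by rewrite E3; split.
  have T3 : arr s3 10 sp = 1 by rewrite E3 /= eqxx.
  have V3 : arr s3 14 sp = evl e d f by rewrite E3 /= eqxx F25.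
  have K3 : same_below sp s2 s3.
    by move=> a i _ Hi; rewrite E3 /= !(ltn_eqF Hi) !if_same.
  case: (IHg _ _ _ _ _ C2 A3) => s4 [j4 [R4 J4 A4 K4]].
  have T4 : arr s4 10 sp = 1 by rewrite K4.
  have V4 : arr s4 14 sp = evl e d f by rewrite K4.
  have E5 : run c_step s4 = run c_or2 (setv s4 8 sp) := step_ret A4 T4.
  set s5 := run c_step s4 in E5.
  case: (A4) => [St4 R4' [G24 G21 G22 G23] G25 G9].
  exists s5, (1 + j2 + 1 + j4 + 1); split.
  + apply: evs_trans; last by apply: evs1 => //; rewrite -/s5 E5.
    apply: evs_trans R4; apply: evs_trans; last first.
      by apply: evs1 => //; rewrite -/s3 E3.
    by apply: evs_trans R2; apply: evs1 => //; rewrite -/s1 E.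
  + lia.
  + rewrite E5; split=> //.
    * by rewrite /= size_cat; split=> //; rewrite G21; lia.
    * rewrite [LHS](_ : _ = eval (EBool (EAdd (EA 14 (V 8)) (V 25))) (setv s4 8 sp)) // eval_bool /=.
      by rewrite V4 G25; case: (evl e d f); case: (evl e d g).
  + move=> a i Ha Hi; have -> : arr s5 a i = arr s4 a i by rewrite E5.
    by rewrite K4 ?K3 ?K2 ?K1 //; lia.
- case/code_cons: C => C0 C1.
  have E : run c_step s = run c_not s := step_eval A C0.
  case: (A) => [St R [E24 E21 E22 E23] E9].
  set s1 := run c_step s in E.
  have A1 : at_eval s1 p.+1 sp.+1 d e.
    rewrite E; split=> //.
    by rewrite /= E21 E22 !addn1.
  have T1 : arr s1 10 sp = 2 by rewrite E /= E22 eqxx.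
  have K1 : same_below sp s s1.
    by move=> a i _ Hi; rewrite E /= E22 (ltn_eqF Hi) if_same.
  case: (IH _ _ _ _ _ C1 A1) => s2 [j2 [R2 J2 A2 K2]].
  have T2 : arr s2 10 sp = 2 by rewrite K2.
  have E3 : run c_step s2 = run c_notr (setv s2 8 sp) := step_ret A2 T2.
  set s3 := run c_step s2 in E3.
  case: (A2) => [St2 R2' [F24 F21 F22 F23] F25 F9].
  exists s3, (1 + j2 + 1); split.
  + apply: evs_trans; last by apply: evs1 => //; rewrite -/s3 E3.
    by apply: evs_trans R2; apply: evs1 => //; rewrite -/s1 E.
  + lia.
  + rewrite E3; split=> //.
    * by rewrite /=; split=> //; rewrite F21; lia.
    * rewrite [LHS](_ : _ = eval (ENot (V 25)) (setv s2 8 sp)) // eval_not /= F25.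
      by case: (evl e d f).
  + move=> a i Ha Hi; have -> : arr s3 a i = arr s2 a i by rewrite E3.
    by rewrite K2 ?K1 //; lia.
- case/code_cons: C => C0 /code_cons [C1 C2].
  have E : run c_step s = run c_ex s := step_eval A C0.
  case: (A) => [St R [E24 E21 E22 E23] E9].
  pose ex j y := if y == x then L j else e y.
  pose frame j acc s := [/\ arr s 10 sp = 3, arr s 11 sp = x, arr s 12 sp = e x
    & [/\ arr s 13 sp = j, arr s 14 sp = nat_of_bool acc & arr s 15 sp = p.+2]].
  pose M := maxn 1 (cn d).
  (* One round with candidate [j], up to the decision whether another candidate follows. *)
  have body j acc s1 : at_eval s1 p.+2 sp.+1 d.+1 (ex j) -> frame j acc s1 ->
      let v := evl (ex j) d.+1 f in
      exists s2 k, [/\ evs k s1 s2, k <= iters d.+1 f,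
        at_ret s2 (p.+2 + size (enc_form f)) sp.+1 d.+1 (ex j) v /\ same_below sp.+1 s1 s2,
        [/\ arr s2 10 sp = 3, arr s2 11 sp = x, arr s2 12 sp = e x & arr s2 15 sp = p.+2]
      & run c_step s2 = run (if j.+1 < cn d then c_next else c_done)
          (setv (seta (seta (setv s2 8 sp) 14 sp (acc || v)) 13 sp j.+1) 9 (cn d))].
    move=> A1 [T1 T2 T3 [T4 T5 T6]] v.
    case: (IH _ _ _ _ _ C2 A1) => s2 [j2 [R2 J2 A2 K2]].
    exists s2, j2; case: (A2) => [St2 R2' [F24 F21 F22 F23] F25 F9].
    have [U1 U2 U3] : [/\ arr s2 10 sp = 3, arr s2 11 sp = x & arr s2 12 sp = e x] by rewrite !K2.
    have [U4 U5 U6] : [/\ arr s2 13 sp = j, arr s2 14 sp = acc & arr s2 15 sp = p.+2]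
      by rewrite !K2.
    have E3 : run c_step s2 = run c_exr (setv s2 8 sp) := step_ret A2 U1.
    split=> //; rewrite E3 -/v in F25 *.
    set t0 := setv s2 8 sp; set t1 := seta t0 14 sp (acc || v).
    set t2 := seta t1 13 sp j.+1.
    have G1 : run (CSt 14 (V 8) (EBool (EAdd (EA 14 (V 8)) (V 25)))) t0 = t1.
      rewrite [LHS](_ : _ = seta t0 14 sp (eval (EBool (EAdd (EA 14 (V 8)) (V 25))) t0)) //.
      by rewrite eval_bool /= U5 F25 /t1; case: (acc); case: (v).
    have G2 : run (CSt 13 (V 8) (EAdd (EA 13 (V 8)) (EC 1))) t1 = t2.
      by rewrite /t2 /= U4 addn1.
    have [N0 _ _ _ Nc] := St2.
    have G3 : run (CIf (ELt (ESub (V 23) (EC 1)) (V 0)) (CSet 9 (EA 8 (ESub (V 23) (EC 1))))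
        (CSet 9 (V 0))) t2 = setv t2 9 (cn d).
      by rewrite run_if eval_lt lt0b /= F23 subn1 /= N0 -Nc /cands; case: ifP.
    rewrite /c_exr !run_seq G1 G2 G3 run_if eval_lt lt0b.
    have -> : (eval (EA 13 (V 8)) (setv t2 9 (cn d)) < eval (V 9) (setv t2 9 (cn d))) = (j.+1 < cn d).
      by rewrite /= eqxx.
    by case: ifP.
  (* Induction on the rounds left after the current one; [acc] is the disjunction of the earlier
     rounds. *)
  have loop : forall m j acc s1, j + m.+1 = M -> at_eval s1 p.+2 sp.+1 d.+1 (ex j) ->
    frame j acc s1 -> exists s' k, [/\ evs k s1 s', k <= m.+1 * (iters d.+1 f + 1),
      at_ret s' (p + (size (enc_form f)).+2) sp d e
        ((0 < n) && (acc || has (fun i => evl (ex i) d.+1 f) (iota j m.+1)))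
      & same_below sp s1 s'].
    elim=> [|m IHm] j acc s1 Hj A1 Fr;
      case: (body _ _ _ A1 Fr) => s2 [j2 []]; set v := evl (ex j) d.+1 f;
      move=> R2 J2 [[St2 R2' [F24 F21 F22 F23] F25 F9] K2] [U1 U2 U3 U6] E3.
    - have Hlt : (j.+1 < cn d) = false by move: Hj; rewrite /M; lia.
      rewrite Hlt in E3; set s3 := run c_step s2 in E3.
      exists s3, (j2 + 1); split.
      + by apply: evs_trans R2 _; apply: evs1 => //; rewrite -/s3 E3.
      + by rewrite mul1n leq_add2r.
      + rewrite E3; split=> //.
        * by split=> //=; [rewrite F21; lia|rewrite F23 subn1].
        * set t3 := setv _ 9 _.
          have [N0 _ _ _ _] := St2.
          rewrite [LHS](_ : _ = eval (EAnd (EA 14 (V 8)) (V 0)) t3) // eval_and /= eqxx N0 lt0b.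
          by rewrite orbF andbC.
        * move=> y; rewrite /= U2 U3; case: eqP => [->|ne] //.
          by rewrite F9 /ex; case: eqP.
      + move=> a i Ha Hi; rewrite -(K2 a i Ha) ?ltnS 1?ltnW // E3 /= !(ltn_eqF Hi) !if_same.
        by case: eqnP => // Ea; move: Ha; rewrite Ea.
    - have Hlt : j.+1 < cn d by move: Hj; rewrite /M; lia.
      rewrite Hlt in E3; set s3 := run c_step s2 in E3.
      have A3 : at_eval s3 p.+2 sp.+1 d.+1 (ex j.+1).
        rewrite E3; split=> //.
        move=> y; rewrite /= U2 eqxx; case: (St2) => _ _ _ -> _.
        by rewrite F9 /ex; case: eqP.
      have Fr3 : frame j.+1 (acc || v) s3.
        by rewrite E3; split=> //; split; rewrite //= eqxx.
      case: (IHm j.+1 (acc || v) s3 _ A3 Fr3) => [|s4 [k [R4 J4 A4 K4]]]; first by lia.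
      exists s4, (j2 + 1 + k); split.
      + apply: evs_trans R4; apply: evs_trans R2 _; apply: evs1 => //.
        by rewrite -/s3 E3.
      + by rewrite mulSn; apply: leq_add => //; rewrite leq_add2r.
      + have -> : has (fun i => evl (ex i) d.+1 f) (iota j m.+2) =
            v || has (fun i => evl (ex i) d.+1 f) (iota j.+1 m.+1) by [].
        by rewrite orbA.
      + move=> a i Ha Hi; rewrite K4 // -(K2 a i Ha) ?ltnS 1?ltnW // E3 /= !(ltn_eqF Hi) !if_same.
        by case: eqnP => // Ea; move: Ha; rewrite Ea.
  set s1 := run c_step s in E.
  have A1 : at_eval s1 p.+2 sp.+1 d.+1 (ex 0).
    rewrite E; split=> //; first by rewrite /= E21 E22 E23 !addn1 addn2.
    move=> y; case: (St) => _ EI _ EL _; rewrite /= EI EL E21 addn1 C1 E9 /ex.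
    by case: eqP.
  have Fr1 : frame 0 false s1.
    case: (St) => _ EI _ _ _; rewrite E; split; rewrite /= ?EI ?E21 ?E22 ?eqxx ?addn1 ?C1 ?E9 //.
    by split=> //; rewrite addn2.
  have M0 : 0 < M by rewrite /M leq_max.
  case: (loop M.-1 0 false s1 _ A1 Fr1) => [|s2 [k [R2 J2 A2 K2]]]; first by lia.
  exists s2, (1 + k); split.
  + by apply: evs_trans R2; apply: evs1 => //; rewrite -/s1 E.
  + by rewrite prednK // in J2; rewrite addnC leq_add2r.
  + by rewrite prednK // in A2.
  + move=> a i Ha Hi; rewrite K2 // E /= E22 !(ltn_eqF Hi) !if_same.
    by case: eqnP => // Ea; move: Ha; rewrite Ea.
Qed.

End Machine.

(** * Correctness and running time *)

(** Each connective adds at most 3 transitions of its own and each quantifier multiplies by at most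
    [m]; only depths below [Q] occur. *)
Lemma iters_le cn f d Q m : 0 < m -> (forall i, i < Q -> maxn 1 (cn i) <= m) ->
  d + nquant f <= Q -> iters cn d f <= 3 * size (enc_form f) * m ^ nquant f.
Proof.
move=> m0 Hm; have mX q : 0 < m ^ q by rewrite expn_gt0 m0.
elim: f d => [x y|x y|f IHf g IHg|f IH|x f IH] d //= Hd.
- have Hf := IHf d ltac:(lia); have Hg := IHg d ltac:(lia).
  rewrite size_cat expnD.
  move: (size (enc_form f)) (size (enc_form g)) (iters cn d f) (iters cn d g) Hf Hg => a b i1 i2.
  by have := mX (nquant f); have := mX (nquant g); nia.
- by have := IH d Hd; have := mX (nquant f); nia.
- have Hf := IH d.+1 ltac:(lia); have Hd1 : maxn 1 (cn d) <= m by apply: Hm; lia.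
  rewrite expnS; apply: leq_trans (_ : m * (3 * size (enc_form f) * m ^ nquant f + 1) + 1 <= _).
    by rewrite leq_add2r; apply: leq_mul => //; rewrite leq_add2r.
  have := mX (nquant f); move: (size _) (m ^ _) => a b; nia.
Qed.

(** Every formula contains an atom, so a sentence has a quantifier. This gives [0 < q], without
    which the base q * X of the time bound would vanish. *)
Lemma free_of_qfree f : nquant f = 0 -> exists v, free_in v f.
Proof.
elim: f => [x y|x y|f IHf g _|f IH|x f _] //=.
- by exists x; rewrite eqxx.
- by exists x; rewrite eqxx.
- by move=> H; case: IHf => [|v Hv]; [lia|exists v; rewrite Hv].
Qed.

Section Correctness.
Variables (n : nat) (G : graph n) (s : state) (k : nat) (lab : 'I_n -> nat).
Hypothesis Bs : base G s.
Hypothesis good : 0 < n -> good_lab G k lab.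
Hypothesis cand : 0 < n -> cand_spec G s k lab.

(** [Z] lists the vertices chosen so far, overwritten ones included, so its length is the depth. A
    new vertex of rank at most [size Z] keeps all ranks below the length of the extended list. *)
Lemma evl_sat f env e (Z : seq 'I_n) :
  (forall y, free_in y f -> exists2 v, env y = Some v & e y = val v) ->
  (forall y u, env y = Some u -> u \in Z) ->
  (forall u, u \in Z -> rank G (highdeg G k) lab (lab u) < size Z) ->
  evl n (arr s 0) (arr s 1) (arr s 7) (cands n s) e (size Z) f <-> sat G env f.
Proof.
elim: f env e Z => [x y|x y|f IHf g IHg|f IH|x f IH] env e Z He HZ HR /=.
- have [u -> ->] := He x ltac:(by rewrite /= eqxx).
  have [v -> ->] := He y ltac:(by rewrite /= eqxx orbT).
  by case: Bs => _ ->; rewrite lt0b.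
- have [u -> ->] := He x ltac:(by rewrite /= eqxx).
  have [v -> ->] := He y ltac:(by rewrite /= eqxx orbT).
  by split=> [/eqP/val_inj|->].
- have F := IHf env e Z (fun y H => He y ltac:(by rewrite /= H)) HZ HR.
  have F' := IHg env e Z (fun y H => He y ltac:(by rewrite /= H orbT)) HZ HR.
  by split=> [/orP [/F|/F']|[/F|/F'] ->]; rewrite ?orbT; auto.
- have F := IH env e Z He HZ HR.
  by split=> [/negP H /F|H]; [|apply/negP => /F].
case: (posnP n) => [n0|n0].
  by split=> // [[v _]]; have := ltn_ord v; rewrite [X in _ < X]n0.
have C := cand n0; have [lt edge conn] := good n0.
(* Applied to the tautology [FEq 0 0], the exchange argument yields a vertex of small rank. Hence
   there is a candidate, and the forced first round is a genuine one. *)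
have [w0 w0r] : exists w, rank G (highdeg G k) lab (lab w) <= size Z.
  have v0 : 'I_n := Ordinal n0.
  case: (@sat_small_rank _ G (highdeg G k) lab lt edge Z (FEq 0 0) env 0 v0 HZ HR) => //.
  by move=> w; exists w.
have F w : rank G (highdeg G k) lab (lab w) <= size Z ->
    evl n (arr s 0) (arr s 1) (arr s 7) (cands n s) (fun y => if y == x then val w else e y)
       (size Z).+1 f <-> sat G (upd env x w) f.
  move=> wr; apply: (IH _ _ (w :: Z)).
  - move=> y Hy; rewrite /upd; case: eqP => [_|ne]; first by exists w.
    by apply: He => /=; rewrite Hy andbT; apply/eqP => E; apply: ne.
  - move=> y u; rewrite /upd; case: eqP => [_ [<-]|_ /HZ H]; rewrite inE ?eqxx //.
    by rewrite H orbT.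
  - by move=> u; rewrite inE => /orP [/eqP ->|/HR /ltnW] //.
have [C1 C2 _] := C (size Z).
have [j0 Hj0 _] := C2 w0 w0r.
have -> : maxn 1 (cands n s (size Z)) = cands n s (size Z).
  by apply/maxn_idPr; apply: leq_ltn_trans Hj0.
split.
- case/andP=> _ /hasP [j]; rewrite mem_iota add0n => /andP [_ Hj] Hev.
  have [w Ew wr] := C1 j Hj; exists w; apply/(F w wr).
  by rewrite Ew in Hev.
- move=> [v Hv]; have [w wr Hw] := sat_small_rank lt edge HZ HR Hv.
  have [j Hj Ej] := C2 w wr; apply/andP; split=> //; apply/hasP; exists j; first by rewrite mem_iota.
  by rewrite Ej; apply/(F w wr).
Qed.

End Correctness.

(** Puts the vertex integrity among the thresholds that are tried. *)
Lemma integrity_bounds n (G : graph n) : 0 < n -> 0 < vertex_integrity G <= n.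
Proof.
move=> n0; apply/andP; split.
  rewrite lt0n; apply/negP => /eqP E.
  have [S] := integrity_witness G; rewrite E leqn0 addn_eq0 => /andP [S0 /eqP C0].
  have {}S0 : S = set0 by apply/eqP; rewrite -cards_eq0.
  have : 0 < max_comp G S.
    rewrite /max_comp; apply: (bigmax_sup (Ordinal n0)); first by rewrite S0 !inE.
    by apply/card_gt0P; exists (Ordinal n0); rewrite inE connect0.
  by rewrite C0.
rewrite /vertex_integrity; elim/big_rec: _ => // S m _ IH.
exact: leq_trans (geq_minr _ _) IH.
Qed.

Lemma rank0_bound n (G : graph n) k lab : vertex_integrity G = k -> good_lab G k lab ->
  rank0 G k lab <= 2 ^ (8 * (k ^ 2 + 1)).
Proof.
move=> <- [lt edge conn]; have [S HS] := integrity_witness G.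
exact: leq_trans (card_rank0 lt edge conn HS) (type_count _).
Qed.

Lemma nth_flatten_rows (T : Type) (x0 : T) n (ss : seq (seq T)) i j :
  all (fun r => size r == n) ss -> j < n ->
  nth x0 (flatten ss) (i * n + j) = nth x0 (nth [::] ss i) j.
Proof.
move=> + Hj; elim: ss i => [|r ss IH] [|i] //=; rewrite ?nth_nil //.
  by case/andP=> /eqP Er _; rewrite nth_cat Er Hj.
case/andP=> /eqP Er /IH <-; rewrite nth_cat Er mulSn -addnA ltnNge leq_addr /=.
by rewrite addKn.
Qed.

Lemma enc_adj n (G : graph n) phi (x y : 'I_n) :
  nth 0 (enc_input G phi) (1 + x * n + y) = adj G x y.
Proof.
have Hxy : x * n + y < n * n.
  have := ltn_ord x; have := ltn_ord y; move: (val x) (val y) => a b; nia.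
rewrite /enc_input /enc_graph -addnA /= nth_cat size_allpairs size_enum_ord Hxy.
rewrite (nth_flatten_rows 0); last by [].
  by rewrite (nth_map x) ?size_enum_ord // (nth_map y) ?size_enum_ord // !nth_ord_enum.
by apply/allP => r /mapP [z _ ->]; rewrite size_map size_enum_ord.
Qed.

Lemma size_enc_input n (G : graph n) phi :
  size (enc_input G phi) = 1 + n * n + size (enc_form phi).
Proof. by rewrite /enc_input /enc_graph size_cat /= size_allpairs size_enum_ord. Qed.

Lemma enc_code n (G : graph n) phi i :
  nth 0 (enc_input G phi) (1 + n * n + i) = nth 0 (enc_form phi) i.
Proof.
rewrite /enc_input nth_cat /enc_graph /= size_allpairs size_enum_ord.
by rewrite ltnNge leq_addr /= addKn.
Qed.

(** 187 is the length of [boot]. The last two instructions move the answer to register 0; running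
    past the end of the program halts. *)
Definition link (c w : cmd) : program :=
  boot ++ comp_c 187 c ++ comp_w (187 + len_c c) 27 w ++
  [:: IConst (ta 0) 0; IAdd 0 (va 25) (ta 0)].

(** Eight steps per copied cell, and [B] is 1024 times the input length. *)
Definition boot_cost := 8 * 1024.

Lemma link_ok c w b inp : 0 < size inp -> wf_c c -> wf_c w -> (forall N, bnd_c w N <= b) ->
  exists s, [/\ var s 0 = nth 0 inp 0, forall i, i < size inp -> arr s 0 i = nth 0 inp i &
    forall j, let s' i := iter i (run w) (run c s) in
      (forall i, i < j -> var (s' i) 27 != 0) -> var (s' j) 27 = 0 ->
      exists2 m, m 0 = var (s' j) 25 &
        reach (link c w) (boot_cost * size inp + 300 + bnd_c c (nth 0 inp 0) +
                          (j * (b + 3) + 1) + 2)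
          (init inp) (RS (size (link c w)) m)].
Proof.
move=> i0 Wc Ww Hb.
have Sb : size boot = 187 by vm_compute.
have C : code_at (link c w) 0 (link c w) by [].
have sz : size (link c w) = (187 + len_c c + (len_c w + 3)).+2.
  rewrite /link size_cat Sb size_cat size_comp_c size_cat size_comp_w.
  by move: (len_c c) (len_c w) => a a' /=; lia.
rewrite sz; move: C; rewrite {2}/link; case/code_at_cat => Cb.
rewrite add0n Sb; case/code_at_cat; rewrite size_comp_c => Ck /code_at_cat [Cw].
rewrite size_comp_w => /code_at_cons [Cz] /code_at_cons [Co _].
case: (boot_ok Cb i0) => [s [m [R1 Rs V0 A0]]].
case: (comp_c_ok Ck Wc Rs) => m1 [R2 Rs1]; rewrite V0 in R2.
exists s; split=> // j s' H1 H2.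
case: (comp_w_ok Cw Ww isT Rs1 Hb H1 H2) => m2 [R3 Rs2].
exists (wr (wr m2 (ta 0) 0) 0 (wr m2 (ta 0) 0 (va 25) + wr m2 (ta 0) 0 (ta 0))).
  by rewrite wrE wrE addn0 wr_ta_va //; case: Rs2 => _ ->.
rewrite mulnA in R1; apply: reach_trans; first by apply: reach_trans (reach_trans R1 R2) R3.
rstep; rstep; exact: reach0.
Qed.

Definition prog : program := link p_kernel c_step.

Definition step_bnd := bnd_c c_step 0.

(** True by computation: [c_step] has no loop and no sum, so [N] disappears from its bound. *)
Lemma step_bndP N : bnd_c c_step N <= step_bnd.
Proof. exact: leqnn. Qed.

Lemma prog_ok n (G : graph n) phi q X : sentence phi -> nquant phi <= q ->
  2 ^ (8 * (vertex_integrity G ^ 2 + 1)) <= X ->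
  let F := size (enc_form phi) in
  exists r : bool, (r <-> models G phi) /\
   exists m : nat -> nat, m 0 = r /\
     reach prog (boot_cost * (1 + n * n + F) + 300 + bnd_c p_kernel n +
                 ((3 * F * (q * X) ^ q + 1) * (step_bnd + 3) + 1) + 2)
       (init (enc_input G phi)) (RS (size prog) m).
Proof.
move=> Sphi Hq HX F.
have q0 : 0 < q.
  case: (posnP (nquant phi)) => [/free_of_qfree [v Hv]|]; last by move/leq_trans; apply.
  by have := Sphi v; rewrite Hv.
have Hsz := size_enc_input G phi.
have i0 : 0 < size (enc_input G phi) by rewrite Hsz.
case: (link_ok i0 wf_kernel wf_step step_bndP) => s [V0 A0 Hrun].
have {}V0 : var s 0 = n by rewrite V0.
have Hadj (x y : 'I_n) : arr s 0 (1 + x * n + y) = adj G x y.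
  rewrite A0 ?enc_adj // Hsz.
  have := ltn_ord x; have := ltn_ord y; move: (val x) (val y) => a b; nia.
case: (kernel_ok V0 Hadj); set s1 := run p_kernel s => B1 I1 V21 [V22 V23 V24 V27] Hc.
have [k [lab [good cand Hmin]]] : exists k lab, [/\ 0 < n -> good_lab G k lab,
    0 < n -> cand_spec G s1 k lab & 0 < n -> rank0 G k lab <= X].
  case: (posnP n) => [n0|n0]; first by exists 0, (fun=> 0); split.
  have [k [lab [g c H]]] := Hc n0; exists k, lab; split=> // _.
  have /andP [ige ile] := integrity_bounds G n0.
  (* The selected threshold is compared with the one equal to the vertex integrity, for which the
     count is estimated; its loop index is one less. *)
  have [|lab' g' le] := H (vertex_integrity G).-1; first by lia.
  rewrite prednK // in g' le.
  exact: leq_trans le (leq_trans (rank0_bound erefl g') HX).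
have [Vn _] := B1.
have St : static n (arr s1 0) (arr s1 1) (arr s1 7) (cands n s1) s1 by split.
have Hcode : code (arr s1 0) (1 + n * n) (enc_form phi).
  by move=> i Hi; rewrite I1 A0 ?enc_code // Hsz ltn_add2l.
have At : at_eval n (arr s1 0) (arr s1 1) (arr s1 7) (cands n s1) s1 (1 + n * n) 0 0 (arr s1 9).
  by split.
case: (eval_ok Hcode At) => s2 [j [[Ej Rj] Hj A2 _]].
set v := evl _ _ _ _ _ _ _ _ in A2.
exists v; split.
  apply: (evl_sat B1 good cand (Z := [::])) => // y Hy.
  by have := Sphi y; rewrite Hy.
case: A2 => _ _ [W24 _ W22 _] W25 _.
have Elast : run c_step s2 = setv s2 27 0.
  have E24 : eval (V 24) s2 = 1 by [].
  have E22 : eval (V 22) s2 = 0 by [].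
  by rewrite /c_step run_if E24 /c_return run_if E22.
have m0 : 0 < q * X.
  by rewrite muln_gt0 q0 /=; apply: leq_trans HX; rewrite expn_gt0.
have HI : iters (cands n s1) 0 phi <= 3 * F * (q * X) ^ q.
  apply: leq_trans (_ : 3 * F * (q * X) ^ nquant phi <= _).
    apply: (iters_le (Q := q)) => // i Hi; rewrite geq_max m0 /=.
    case: (posnP n) => [n0|n0]; first by rewrite /cands n0.
    have [_ _ le] := cand n0 i; apply: leq_trans le _.
    by apply: leq_mul => //; apply: Hmin.
  by rewrite leq_mul2l leq_pexp2l ?orbT.
case: (Hrun j.+1) => [i Hi| |m Hm R]; first by rewrite Rj.
  by rewrite iterS Ej Elast.
exists m; split; first by rewrite Hm iterS Ej Elast.
rewrite Hsz in R; apply: reach_le R.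
rewrite [nth 0 _ 0]/= !(leq_add2l, leq_add2r) leq_mul2r; apply/orP; right.
by rewrite addn1 ltnS; apply: leq_trans HI.
Qed.

Lemma exec_end P f m : exec P f.+1 (RS (size P) m) = Some (m 0).
Proof. by rewrite /= nth_default. Qed.

(** A constant factor [W] is below 2^W and so fits into the exponent, as the outer power [q] is at
    least 1. It is applied with k^2 in place of [k]. *)
Lemma time_bound W q F k I : 0 < q -> I <= W * (F * (q * 2 ^ (8 * k.+1)) ^ q) ->
  I <= (2 ^ ((W + 8) * k.+1) * q) ^ q * F.
Proof.
move=> q0 H; apply: leq_trans H _.
rewrite mulnCA mulnC leq_mul2r; apply/orP; right.
have -> : 2 ^ ((W + 8) * k.+1) * q = 2 ^ (W * k.+1) * (q * 2 ^ (8 * k.+1)).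
  by rewrite mulnDl expnD -mulnA [_ * q]mulnC.
rewrite [X in _ <= X]expnMn leq_mul2r; apply/orP; right.
apply: leq_trans (ltnW (ltn_expl W (isT : 1 < 2))) _.
rewrite -expnM leq_exp2l // -{1}[W]muln1 -mulnA leq_mul2l.
by rewrite muln_gt0 q0 orbT.
Qed.

(** The terms in [F] and the cost c + 3 of the final transition go to the first summand, with W = a
    + 4 (c + 3); the rest is polynomial in [n]. 304 collects the additive constants, and the
    exponent d + 2 also covers n * n. *)
Lemma total_bound a c K d n q F k e : 0 < q -> 0 < F -> e <= K * n.+1 ^ d ->
  a * (1 + n * n + F) + 300 + e + ((3 * F * (q * 2 ^ (8 * (k ^ 2 + 1))) ^ q + 1) * (c + 3) + 1)
    + 2 + 1 <=
  (2 ^ ((a + 4 * (c + 3) + 8) * (k ^ 2 + 1)) * q) ^ q * F + (a + 304 + K) * (n + 1) ^ (d + 2).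
Proof.
move=> q0 F0 He; rewrite (addn1 (k ^ 2)) (addn1 n); set m := (q * _) ^ q.
have m0 : 0 < m by rewrite expn_gt0 muln_gt0 q0 expn_gt0.
have A1 : a * F + (3 * F * m + 1) * (c + 3) <=
    (2 ^ ((a + 4 * (c + 3) + 8) * (k ^ 2).+1) * q) ^ q * F.
  apply: time_bound => //; rewrite -/m.
  have y0 : 0 < F * m by rewrite muln_gt0 F0.
  have Fy : F <= F * m by rewrite -{1}[F]muln1 leq_mul2l m0 orbT.
  rewrite -(mulnA 3); move: (F * m) (c + 3) y0 Fy => y b y0 Fy.
  by rewrite [X in _ <= X]mulnDl; apply: leq_add; [rewrite leq_mul2l Fy orbT|nia].
have A2 : a * (1 + n * n) + 304 + e <= (a + 304 + K) * n.+1 ^ (d + 2).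
  have P0 : 0 < n.+1 ^ d by rewrite expn_gt0.
  have P1 : n.+1 ^ d <= n.+1 ^ (d + 2) by rewrite leq_pexp2l ?leq_addr.
  have P2 : 1 + n * n <= n.+1 ^ (d + 2).
    rewrite expnD; apply: leq_trans (_ : n.+1 ^ 2 <= _); first by nia.
    by rewrite -{1}[n.+1 ^ 2]mul1n leq_mul2r P0 orbT.
  have P3 : 0 < n.+1 ^ (d + 2) by rewrite expn_gt0.
  rewrite !mulnDl; apply: leq_add; first apply: leq_add.
  - by rewrite leq_mul2l P2 orbT.
  - by rewrite leq_pmulr.
  - by apply: leq_trans He _; rewrite leq_mul2l P1 orbT.
apply: leq_trans (leq_add A1 A2); rewrite mulnDr.
by move: (a * F) (a * (1 + n * n)) ((_ + 1) * _) => x y z; lia.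
Qed.

Theorem theorem10 :
  exists (P : program) (c C d : nat),
    forall (n : nat) (G : graph n) (k q : nat) (phi : form),
      sentence phi -> prenex phi -> nquant phi <= q ->
      vertex_integrity G <= k ->
      let T := (2 ^ (c * (k ^ 2 + 1)) * q) ^ q * size (enc_form phi)
               + C * (n + 1) ^ d in
      (exec P T (init (enc_input G phi)) = Some 1 /\ models G phi) \/
      (exec P T (init (enc_input G phi)) = Some 0 /\ ~ models G phi).
Proof.
have [K [d HK]] := bnd_c_poly p_kernel.
exists prog, (boot_cost + 4 * (step_bnd + 3) + 8), (boot_cost + 304 + K), (d + 2).
move=> n G k q phi Sphi _ Hq Hk.
have q0 : 0 < q.
  case: (posnP (nquant phi)) => [/free_of_qfree [v Hv]|]; last by move/leq_trans; apply.
  by have := Sphi v; rewrite Hv.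
have HX : 2 ^ (8 * (vertex_integrity G ^ 2 + 1)) <= 2 ^ (8 * (k ^ 2 + 1)).
  by rewrite leq_exp2l // leq_mul2l leq_add2r leq_exp2r.
have [r [Hr [m [Em R]]]] := prog_ok Sphi Hq HX.
have F0 : 0 < size (enc_form phi) by case: (phi).
have HT := total_bound boot_cost step_bnd k q0 F0 (HK n).
move=> T; rewrite -/T in HT.
have E : exec prog T (init (enc_input G phi)) = Some (nat_of_bool r).
  rewrite -(subnK HT) addnC -addnA.
  by apply: (exec_reach R); rewrite add1n exec_end Em.
by rewrite E; case: r Hr {E Em} => Hr; [left|right]; split=> //; [apply/Hr|move/Hr].
Qed.
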